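(* Let $0\ne f\in\langle x_1,\dots,x_n\rangle\lhd\mathbb{C}\{x_1,\dots,x_n\}$ and $X=V(f)$. If the singular locus $\operatorname{Sing}X$ is quasihomogeneous, then $f$ is strongly Euler homogeneous, i.e. $f\in\langle x_1,\dots,x_n\rangle\cdot\mathcal J_f$ where $\mathcal J_f=\langle \partial f/\partial x_1,\dots,\partial f/\partial x_n\rangle$.
   Context: $\operatorname{Sing}X$ is the space germ with local algebra $\mathcal O_{\operatorname{Sing}X}=\mathbb{C}\{x_1,\dots,x_n\}/\tilde{\mathcal J}_f$, where $\tilde{\mathcal J}_f=\langle \partial f/\partial x_1,\dots,\partial f/\partial x_n,f\rangle$. A space germ with local analytic algebra $(\mathcal O,\mathfrak m)$ is quasihomogeneous if there exist minimal generators $y_1,\dots,y_m$ of $\mathfrak m$, positive rationals $w_1,\dots,w_m$ and a $\mathbb{C}$-linear derivation $\chi:\mathcal O\to\mathcal O$ with $\chi(y_i)=w_iy_i$ for all $i$ (an Euler derivation $\chi=\sum_i w_iy_i\,\partial/\partial y_i$). *)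

(* Defs.v *)
(* Convergent power series C{x_1,...,x_n} encoded by their
   coefficient functions, with C := R[i] for a real type R. *)
From HB Require Import structures.
From mathcomp Require Import all_boot all_order all_algebra.
From mathcomp Require Import reals.
From mathcomp Require Import complex.
Set Implicit Arguments. Unset Strict Implicit. Unset Printing Implicit Defensive.
Import Order.TTheory GRing.Theory Num.Theory.
Local Open Scope ring_scope.
Local Open Scope complex_scope.

Section PS.
Variables (R : realType) (n : nat).
Notation C := R[i].

Definition mindex := {ffun 'I_n -> nat}.
Definition mdeg (al : mindex) : nat := (\sum_(i < n) al i)%N.
Definition mzero : mindex := [ffun => 0%N].
Definition munit (i : 'I_n) : mindex := [ffun j => (j == i)%N : nat].
Definition madd (al be : mindex) : mindex := [ffun j => (al j + be j)%N].
Definition msub (al be : mindex) : mindex := [ffun j => (al j - be j)%N].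

Definition ps := mindex -> C.

(* convergent: coefficients satisfy a Cauchy estimate |a_al| r^|al| <= M,
   i.e. the series converges on some polydisc around 0 *)
Definition convergent (a : ps) : Prop :=
  exists r M : R, 0 < r /\ forall al, `|a al| * ((r ^+ mdeg al)%:C) <= M%:C.

Definition ps_add (a b : ps) : ps := fun al => a al + b al.
Definition ps_sub (a b : ps) : ps := fun al => a al - b al.
Definition ps_scale (c : C) (a : ps) : ps := fun al => c * a al.

Definition ps_mul (a b : ps) : ps := fun al =>
  \sum_(be : {ffun 'I_n -> 'I_(mdeg al).+1} | [forall j, (be j <= al j)%N])
     a [ffun j => (be j : nat)] * b (msub al [ffun j => (be j : nat)]).

Definition ps_var (i : 'I_n) : ps := fun al => (al == munit i)%:R.

Definition ps_deriv (i : 'I_n) (a : ps) : ps :=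
  fun al => (al i).+1%:R * a (madd al (munit i)).

Definition in_max (a : ps) : Prop := convergent a /\ a mzero = 0.

Definition in_tJ (f g : ps) : Prop :=
  exists (h : 'I_n -> ps) (h0 : ps),
    (forall j, convergent (h j)) /\ convergent h0 /\
    forall al, g al = \sum_(j < n) ps_mul (h j) (ps_deriv j f) al
                      + ps_mul h0 f al.

(* congruence modulo tilde J_f: equality in O_{Sing X} = C{x}/tilde J_f *)
Definition eqJ (f a b : ps) : Prop := in_tJ f (ps_sub a b).

Definition in_maxO (f a : ps) : Prop :=
  convergent a /\ exists z, in_max z /\ eqJ f a z.

Definition generates_maxO (f : ps) (m : nat) (y : 'I_m -> ps)
    (P : pred 'I_m) : Prop :=
  forall a, in_maxO f a ->
    exists h : 'I_m -> ps, (forall j, convergent (h j)) /\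
      eqJ f a (fun al => \sum_(j < m | P j) ps_mul (h j) (y j) al).

Definition minimal_generators_maxO (f : ps) (m : nat) (y : 'I_m -> ps) : Prop :=
  (forall j, in_maxO f (y j)) /\
  generates_maxO f y predT /\
  (forall i, ~ generates_maxO f y (predC1 i)).

(* chi (acting on representatives) induces a C-linear derivation of
   O_{Sing X} = C{x}/tilde J_f *)
Definition derivationO (f : ps) (chi : ps -> ps) : Prop :=
  (forall a, convergent a -> convergent (chi a)) /\
  (forall a b, convergent a -> convergent b -> eqJ f a b -> eqJ f (chi a) (chi b)) /\
  (forall c a b, convergent a -> convergent b ->
     eqJ f (chi (ps_add (ps_scale c a) b)) (ps_add (ps_scale c (chi a)) (chi b))) /\
  (forall a b, convergent a -> convergent b ->
     eqJ f (chi (ps_mul a b)) (ps_add (ps_mul a (chi b)) (ps_mul b (chi a)))).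

Definition SingX_quasihomogeneous (f : ps) : Prop :=
  exists (m : nat) (y : 'I_m -> ps) (w : 'I_m -> rat) (chi : ps -> ps),
    minimal_generators_maxO f y /\ (forall j, 0 < w j) /\
    derivationO f chi /\
    (forall j, eqJ f (chi (y j)) (ps_scale (ratr (w j)) (y j))).

Definition strongly_Euler_homogeneous (f : ps) : Prop :=
  exists g : 'I_n -> ps, (forall j, in_max (g j)) /\
    forall al, f al = \sum_(j < n) ps_mul (g j) (ps_deriv j f) al.

End PS.

(* Main.v *)
(** The singular locus carries a derivation [chi] of [O / tJ], [tJ = <df, f>], with
    positive eigenvalues on the cotangent space.  It lifts to a vector field [eta]
    on [O] that preserves [tJ]; correcting the lift by elements of [tJ] makes the
    linear part of [eta] diagonalisable with positive eigenvalues, so on each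
    [m / m^k] a product of operators [eta - l] with [l > 0] vanishes.  Hence
    [f = eta h + O(m^k)] with [h] a polynomial in [eta] applied to [f].  As
    [[d_i, eta]] is a combination of the [d_j], all [d_i h] lie in [tJ], and
    [eta h] lies in [m tJ].  Thus [f] is in [m tJ + m^k] for all [k], and Nakayama
    together with the closedness of ideals in the [m]-adic topology gives
    [f] in [m J_f].

    Closedness of ideals is also what makes [chi] and [eta] agree modulo [tJ].  It
    comes from Grauert division by a standard basis: a remainder in the closure
    of the ideal has no initial exponent left. *)
From HB Require Import structures.
Require Import Defs.
From mathcomp Require Import all_boot all_order all_algebra reals complex boolp.
From mathcomp Require Import ring lra zify.
Set Implicit Arguments. Unset Strict Implicit. Unset Printing Implicit Defensive.
Import Order.TTheory GRing.Theory Num.Theory.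
Local Open Scope ring_scope.

(** * Multi-indices and the ring of power series *)

Section Multiindices.
Variable n : nat.
Implicit Types a b c : mindex n.

Definition mle a b := [forall j, (a j <= b j)%N].

Lemma mleP a b : reflect (forall j, (a j <= b j)%N) (mle a b).
Proof. exact: forallP. Qed.

Lemma mle_trans b a c : mle a b -> mle b c -> mle a c.
Proof. by move=> /mleP h1 /mleP h2; apply/mleP => j; apply: leq_trans (h1 j) (h2 j). Qed.

Lemma maddE a b j : madd a b j = (a j + b j)%N.
Proof. by rewrite ffunE. Qed.

Lemma msubE a b j : msub a b j = (a j - b j)%N.
Proof. by rewrite ffunE. Qed.

Lemma munitE (i j : 'I_n) : munit i j = (j == i)%N.
Proof. by rewrite ffunE. Qed.

Lemma maddC a b : madd a b = madd b a.
Proof. by apply/ffunP => j; rewrite !maddE addnC. Qed.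

Lemma maddA a b c : madd a (madd b c) = madd (madd a b) c.
Proof. by apply/ffunP => j; rewrite !maddE addnA. Qed.

Lemma maddK a b : msub (madd a b) b = a.
Proof. by apply/ffunP => j; rewrite msubE maddE addnK. Qed.

Lemma msubK a b : mle b a -> madd (msub a b) b = a.
Proof. by move=> /mleP h; apply/ffunP => j; rewrite maddE msubE subnK. Qed.

Lemma mle_add a b : mle b (madd a b).
Proof. by apply/mleP => j; rewrite maddE leq_addl. Qed.

Lemma mle_sub a b : mle (msub a b) a.
Proof. by apply/mleP => j; rewrite msubE leq_subr. Qed.

Lemma mle0 a : mle (mzero n) a.
Proof. by apply/mleP => j; rewrite ffunE. Qed.

Lemma mdegD a b : mdeg (madd a b) = (mdeg a + mdeg b)%N.
Proof. by rewrite /mdeg -big_split; apply: eq_bigr => j _; rewrite maddE. Qed.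

Lemma mdeg0 : mdeg (mzero n) = 0%N.
Proof. by rewrite /mdeg big1 // => j _; rewrite ffunE. Qed.

Lemma mdeg_unit (i : 'I_n) : mdeg (munit i) = 1%N.
Proof.
rewrite /mdeg (bigD1 i) //= munitE eqxx big1 // => j /negPf ji.
by rewrite munitE ji.
Qed.

Lemma leq_mdeg a j : (a j <= mdeg a)%N.
Proof. by rewrite /mdeg (bigD1 j) //= leq_addr. Qed.

Lemma mdeg_eq0 a : (mdeg a == 0%N) = (a == mzero n).
Proof.
apply/eqP/eqP => [h|->]; last exact: mdeg0.
by apply/ffunP => j; rewrite ffunE; move: (leq_mdeg a j); rewrite h; case: (a j).
Qed.

Definition mval d (be : {ffun 'I_n -> 'I_d.+1}) : mindex n :=
  [ffun j => (be j : nat)].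

Lemma mval_inj d : injective (@mval d).
Proof.
by move=> x y /ffunP h; apply/ffunP => j; apply: val_inj; move: (h j); rewrite !ffunE.
Qed.

(** The index set of [ps_mul] depends on [mdeg a] through its type. A list of multi-indices lets
    sums for different [a] be compared and reindexed. *)
Definition below a : seq (mindex n) :=
  [seq mval be | be : {ffun 'I_n -> 'I_(mdeg a).+1} in
    [pred be : {ffun 'I_n -> 'I_(mdeg a).+1} | [forall j, (be j <= a j)%N]]].

Lemma mem_below a b : (b \in below a) = mle b a.
Proof.
apply/imageP/idP => [[be /forallP h ->]|/mleP h].
  by apply/mleP => j; rewrite ffunE.
have e j : (inord (b j) : 'I_(mdeg a).+1) = b j :> nat.
  by rewrite inordK // ltnS; apply: leq_trans (h j) (leq_mdeg a j).
exists [ffun j => inord (b j) : 'I_(mdeg a).+1]; last first.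
  by apply/ffunP => j; rewrite !ffunE e.
by rewrite inE; apply/forallP => j; rewrite ffunE e.
Qed.

Lemma below_uniq a : uniq (below a).
Proof. by rewrite map_inj_uniq ?enum_uniq //; apply: mval_inj. Qed.

Lemma perm_below_sub a : perm_eq (below a) [seq msub a b | b <- below a].
Proof.
have h b : mle b a -> msub a (msub a b) = b.
  by move=> /mleP h; apply/ffunP => j; rewrite !msubE subKn.
apply: uniq_perm; rewrite ?below_uniq //.
  rewrite map_inj_in_uniq ?below_uniq // => x y; rewrite !mem_below => hx hy e.
  by rewrite -(h x hx) e h.
move=> b; rewrite mem_below; apply/idP/mapP => [hb|[c _ ->]]; last exact: mle_sub.
by exists (msub a b); rewrite ?mem_below ?mle_sub ?h.
Qed.

Lemma perm_below_ge a c : mle c a ->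
  perm_eq [seq b <- below a | mle c b] [seq madd c b | b <- below (msub a c)].
Proof.
move=> /mleP ca; apply: uniq_perm; rewrite ?filter_uniq ?below_uniq //.
  rewrite map_inj_uniq ?below_uniq // => x y.
  by rewrite !(maddC c) => e; rewrite -(maddK x c) e maddK.
move=> b; rewrite mem_filter mem_below; apply/andP/mapP => [[/mleP cb /mleP ba]|[d]].
  exists (msub b c); first by rewrite mem_below; apply/mleP => j; rewrite !msubE leq_sub2r.
  by rewrite maddC msubK //; apply/mleP.
rewrite mem_below => /mleP h ->; split; first by rewrite maddC mle_add.
by apply/mleP => j; move: (h j) (ca j); rewrite msubE maddE; lia.
Qed.

Lemma perm_below_le a b : mle b a ->
  perm_eq (below b) [seq c <- below a | mle c b].
Proof.
move=> ba; apply: uniq_perm; rewrite ?filter_uniq ?below_uniq // => c.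
rewrite mem_filter !mem_below; apply/idP/andP => [h|[]//].
by split=> //; apply: mle_trans ba.
Qed.

(** Induction on the coordinates in [l]. Let [B0] serve for the old coordinates. A point whose new
    coordinate is at least the maximum over [B0] is dominated by [B0]. The others lie in finitely
    many slices on which the new coordinate is constant, and each slice falls under the induction
    hypothesis. *)
Lemma dickson_on (l : seq 'I_n) (S : mindex n -> Prop) :
  exists2 B : seq (mindex n), (forall b, b \in B -> S b) &
    forall s, S s -> exists2 b, b \in B & forall j, j \in l -> (b j <= s j)%N.
Proof.
elim: l S => [|i l IH] S.
  have [[s Ss]|nS] := pselect (exists s, S s); last first.
    by exists [::] => // s Ss; case: nS; exists s.
  by exists [:: s] => [b|t _]; [rewrite inE => /eqP -> | exists s; rewrite ?inE].
have [B0 B0S hB0] := IH S.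
have slices k : exists2 B : seq (mindex n), (forall b, b \in B -> S b) &
    forall s, S s -> (s i < k)%N -> exists2 b, b \in B & forall j, j \in i :: l -> (b j <= s j)%N.
  elim: k => [|k [B BS hB]]; first by exists [::].
  have [B' B'S hB'] := IH (fun s => S s /\ s i = k).
  exists (B ++ B') => [b|s Ss].
    by rewrite mem_cat => /orP [/BS|/B'S []].
  rewrite ltnS leq_eqVlt => /orP [/eqP si|/(hB _ Ss) [b bB h]]; last first.
    by exists b => //; rewrite mem_cat bB.
  have [b bB h] := hB' s (conj Ss si); exists b; first by rewrite mem_cat bB orbT.
  move=> j; rewrite inE => /orP [/eqP ->|/h //].
  by rewrite si; have [_ ->] := B'S _ bB.
have [B1 B1S hB1] := slices (\max_(b <- B0) b i)%N.
exists (B0 ++ B1) => [b|s Ss]; first by rewrite mem_cat => /orP [/B0S|/B1S].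
have [lt|ge] := ltnP (s i) (\max_(b <- B0) b i)%N.
  by have [b bB h] := hB1 s Ss lt; exists b => //; rewrite mem_cat bB orbT.
have [b bB h] := hB0 s Ss; exists b; first by rewrite mem_cat bB.
move=> j; rewrite inE => /orP [/eqP ->|/h //].
by apply: leq_trans ge; rewrite (big_rem b) //= leq_maxl.
Qed.

Lemma dickson (S : mindex n -> Prop) :
  exists2 B : seq (mindex n), (forall b, b \in B -> S b) &
    forall s, S s -> exists2 b, b \in B & mle b s.
Proof.
have [B BS h] := dickson_on (enum 'I_n) S; exists B => // s /h [b bB hb].
by exists b => //; apply/mleP => j; apply: hb; rewrite mem_enum.
Qed.

End Multiindices.

Section Ring.
Variables (R : realType) (n : nat).
Notation ps := (ps R n).
Implicit Types a b c : ps.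

Lemma ps_mulE a b al :
  ps_mul a b al = \sum_(be <- below al) a be * b (msub al be).
Proof. by rewrite /below big_image. Qed.

Definition ps_mono (be : mindex n) : ps := fun al => (al == be)%:R.

Lemma ps_mul_mono be a al :
  ps_mul (ps_mono be) a al = if mle be al then a (msub al be) else 0.
Proof.
rewrite ps_mulE; case: ifP => h.
  rewrite (bigD1_seq be) ?mem_below ?below_uniq //= /ps_mono eqxx mul1r.
  by rewrite big1 ?addr0 // => c /negPf ->; rewrite mul0r.
rewrite big_seq big1 // => c; rewrite mem_below /ps_mono; case: eqP => [->|_ _].
  by rewrite h.
by rewrite mul0r.
Qed.

Lemma ps_mulC : commutative (@ps_mul R n).
Proof.
move=> a b; apply/funext => al; rewrite !ps_mulE (perm_big _ (perm_below_sub al)) big_map.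
rewrite big_seq [RHS]big_seq; apply: eq_bigr => be; rewrite mem_below => /mleP h.
rewrite mulrC; congr (b _ * _); apply/ffunP => j.
by rewrite !msubE subKn.
Qed.

Lemma ps_mulA : associative (@ps_mul R n).
Proof.
move=> a b c; apply/funext => al; rewrite !ps_mulE.
(* Both products are the sum over chains [ga <= be <= al]; the left one is reached by exchanging the
   sums and shifting by [ga]. *)
transitivity (\sum_(be <- below al) \sum_(ga <- below al | mle ga be)
   a ga * b (msub be ga) * c (msub al be)).
  rewrite (exchange_big_dep predT) //= big_seq [RHS]big_seq.
  apply: eq_bigr => ga; rewrite mem_below => h.
  rewrite -[RHS]big_filter (perm_big _ (perm_below_ge h)) big_map.
  rewrite ps_mulE mulr_sumr; apply: eq_bigr => de _; rewrite mulrA.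
  congr (_ * b _ * c _); first by rewrite maddC maddK.
  by apply/ffunP => j; rewrite !ffunE subnDA.
rewrite big_seq [RHS]big_seq; apply: eq_bigr => be; rewrite mem_below => h.
rewrite ps_mulE mulr_suml -big_filter.
by rewrite -(perm_big _ (perm_below_le h)).
Qed.

Lemma ps_mul1 : left_id (ps_mono (mzero n)) (@ps_mul R n).
Proof.
move=> a; apply/funext => al; rewrite ps_mul_mono mle0; congr (a _).
by apply/ffunP => j; rewrite !ffunE subn0.
Qed.

Lemma ps_mulDl : left_distributive (@ps_mul R n) (@ps_add R n).
Proof.
move=> a b c; apply/funext => al; rewrite /ps_add !ps_mulE -big_split.
by apply: eq_bigr => be _; rewrite mulrDl.
Qed.

Lemma ps_addA : associative (@ps_add R n).
Proof. by move=> a b c; apply/funext => al; apply: addrA. Qed.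
Lemma ps_addC : commutative (@ps_add R n).
Proof. by move=> a b; apply/funext => al; apply: addrC. Qed.
Lemma ps_add0 : left_id (fun=> 0 : R[i]) (@ps_add R n).
Proof. by move=> a; apply/funext => al; apply: add0r. Qed.
Lemma ps_addN : left_inverse (fun=> 0 : R[i]) (fun a al => - a al) (@ps_add R n).
Proof. by move=> a; apply/funext => al; apply: addNr. Qed.
Lemma ps_1neq0 : ps_mono (mzero n) != (fun=> 0) :> (mindex n -> R[i]).
Proof.
by apply/eqP => /(congr1 (fun a => a (mzero n))) /eqP; rewrite /ps_mono eqxx oner_eq0.
Qed.

End Ring.

(** Classical equality and choice on functions give all formal series a commutative ring structure;
    convergence stays a separate predicate. *)
HB.instance Definition _ (R : realType) n := gen_eqMixin (ps R n).
HB.instance Definition _ (R : realType) n := gen_choiceMixin (ps R n).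
HB.instance Definition _ (R : realType) n :=
  GRing.isZmodule.Build (ps R n) (@ps_addA R n) (@ps_addC R n) (@ps_add0 R n) (@ps_addN R n).
HB.instance Definition _ (R : realType) n :=
  GRing.Zmodule_isComNzRing.Build (ps R n) (@ps_mulA R n) (@ps_mulC R n)
    (@ps_mul1 R n) (@ps_mulDl R n) (@ps_1neq0 R n).

Section Coefs.
Variables (R : realType) (n : nat).
Notation ps := (ps R n).
Implicit Types a b c : ps.

Lemma psDE a b al : (a + b) al = a al + b al. Proof. by []. Qed.
Lemma psNE a al : (- a) al = - a al. Proof. by []. Qed.
Lemma ps0E al : (0 : ps) al = 0. Proof. by []. Qed.
Lemma psME a b al : (a * b) al = \sum_(be <- below al) a be * b (msub al be).
Proof. exact: ps_mulE. Qed.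
Lemma ps_sumE (I : Type) (r : seq I) (P : pred I) (F : I -> ps) al :
  (\sum_(i <- r | P i) F i) al = \sum_(i <- r | P i) F i al.
Proof. exact: (big_morph (fun a : ps => a al)). Qed.

End Coefs.

(** * Convergence estimates *)

Section Convergence.
Variables (R : realType) (n : nat).
Notation ps := (ps R n).
Implicit Types a b c : ps.

(** The norm of [R[i]] takes values in [R[i]]; estimates are easier with a modulus in the ordered
    field [R]. *)
Definition cnorm (z : R[i]) : R := Normc.normc z.

Lemma cnormE (z : R[i]) : `|z| = real_complex R (cnorm z).
Proof. by []. Qed.

Lemma cnorm_ge0 z : 0 <= cnorm z.
Proof. by rewrite -lecR -cnormE normr_ge0. Qed.

Lemma cnormM x y : cnorm (x * y) = cnorm x * cnorm y.
Proof. exact: Normc.normcM. Qed.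

Lemma cnormD x y : cnorm (x + y) <= cnorm x + cnorm y.
Proof. by rewrite -lecR rmorphD -!cnormE ler_normD. Qed.

Lemma cnormN x : cnorm (- x) = cnorm x.
Proof. by apply: (@complexI R); rewrite -!cnormE normrN. Qed.

Lemma cnorm0 : cnorm 0 = 0.
Proof. by apply: (@complexI R); rewrite -!cnormE normr0. Qed.

Lemma cnorm_nat k : cnorm k%:R = k%:R.
Proof. by apply: (@complexI R); rewrite -cnormE normr_nat rmorph_nat. Qed.

Lemma cnorm_sum (I : Type) (r : seq I) (P : pred I) (F : I -> R[i]) :
  cnorm (\sum_(i <- r | P i) F i) <= \sum_(i <- r | P i) cnorm (F i).
Proof.
elim/big_rec2: _ => [|i y x _ h]; first by rewrite cnorm0.
by apply: le_trans (cnormD _ _) _; rewrite lerD2l.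
Qed.

Lemma convergentP a : convergent a <->
  exists r M : R, 0 < r /\ forall al, cnorm (a al) * r ^+ mdeg al <= M.
Proof.
have E (r M : R) al :
    (`|a al| * real_complex R (r ^+ mdeg al) <= real_complex R M) =
    (cnorm (a al) * r ^+ mdeg al <= M).
  by rewrite cnormE -rmorphM lecR.
by split=> -[r [M [r0 h]]]; exists r, M; split=> // al; move: (h al); rewrite -?E.
Qed.

Lemma convergent_bound a : convergent a -> exists r M : R,
  [/\ 0 < r, r <= 1, 0 <= M & forall t al, 0 <= t -> t <= r -> cnorm (a al) * t ^+ mdeg al <= M].
Proof.
move=> /convergentP [r [M [r0 h]]].
exists (Num.min r 1), M; split; rewrite ?lt_min ?r0 ?ltr01 ?ge_min ?lexx ?orbT //.
  by apply: le_trans (h (mzero n)); rewrite mdeg0 expr0 mulr1 cnorm_ge0.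
move=> t al t0; rewrite le_min => /andP [tr _]; apply: le_trans (h al).
by rewrite ler_wpM2l ?cnorm_ge0 // lerXn2r ?nnegrE // ltW.
Qed.

Lemma geometric_sum d : \sum_(k < d) (2^-1 : R) ^+ k <= 2.
Proof.
suff -> : \sum_(k < d) (2^-1 : R) ^+ k = 2 - 2 * 2^-1 ^+ d.
  have : (0 : R) <= 2^-1 ^+ d by rewrite exprn_ge0 // invr_ge0.
  by move: (_ ^+ _) => u; lra.
elim: d => [|d IH]; first by rewrite big_ord0 expr0; lra.
by rewrite big_ord_recr /= IH exprS; move: (_ ^+ _) => u; lra.
Qed.

(** Enlarging the box to a cube turns the sum into a product of [n] geometric sums, each at most 2.
    The bound does not depend on [be]. *)
Lemma geometric_below (be : mindex n) :
  \sum_(al <- below be) (2^-1 : R) ^+ mdeg al <= 2 ^+ n.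
Proof.
rewrite /below big_image /=.
have h0 k : 0 <= (2^-1 : R) ^+ k by rewrite exprn_ge0 // invr_ge0.
apply: (@le_trans _ _ (\sum_(f : {ffun 'I_n -> 'I_(mdeg be).+1}) (2^-1 : R) ^+ mdeg (mval f))).
  rewrite [leRHS](bigID [pred f : {ffun 'I_n -> 'I_(mdeg be).+1} | [forall j, (f j <= be j)%N]]) /=.
  by rewrite lerDl sumr_ge0.
rewrite (eq_bigr (fun f : {ffun 'I_n -> 'I_(mdeg be).+1} => \prod_(i < n) (2^-1 : R) ^+ f i)).
  rewrite -(bigA_distr_bigA (fun (_ : 'I_n) (k : 'I_(mdeg be).+1) => (2^-1 : R) ^+ k)).
  rewrite -[X in _ <= _ ^+ X](card_ord n) -prodr_const; apply: ler_prod => i _.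
  by rewrite geometric_sum sumr_ge0.
move=> f _; rewrite /mdeg -expr_sum; congr (_ ^+ _); apply: eq_bigr => i _.
by rewrite ffunE.
Qed.

Lemma convergent0 : convergent (0 : ps).
Proof. by apply/convergentP; exists 1, 0; split=> // al; rewrite cnorm0 mul0r. Qed.

Lemma convergentD a b : convergent a -> convergent b -> convergent (a + b).
Proof.
move=> /convergent_bound [r [M [r0 _ _ h]]] /convergent_bound [s [N [s0 _ _ k]]].
apply/convergentP; exists (Num.min r s), (M + N); rewrite lt_min r0 s0; split=> // al.
have m0 : 0 <= Num.min r s by rewrite le_min !ltW.
apply: (@le_trans _ _ ((cnorm (a al) + cnorm (b al)) * Num.min r s ^+ mdeg al)).
  by rewrite ler_wpM2r ?exprn_ge0 // cnormD.
by rewrite mulrDl lerD ?h ?k // ge_min lexx ?orbT.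
Qed.

Lemma convergentN a : convergent a -> convergent (- a).
Proof.
move=> /convergentP [r [M [r0 h]]]; apply/convergentP.
by exists r, M; split=> // al; rewrite cnormN.
Qed.

Lemma convergentB a b : convergent a -> convergent b -> convergent (a - b).
Proof. by move=> ha hb; apply: convergentD => //; apply: convergentN. Qed.

Lemma convergent_sum (I : Type) (r : seq I) (P : pred I) (F : I -> ps) :
  (forall i, P i -> convergent (F i)) -> convergent (\sum_(i <- r | P i) F i).
Proof. by move=> h; apply: big_ind => //; [exact: convergent0 | exact: convergentD]. Qed.

Lemma expr_half (r : R) k : (r / 2) ^+ k = r ^+ k * 2^-1 ^+ k.
Proof. by rewrite exprMn. Qed.

Lemma convergentM a b : convergent a -> convergent b -> convergent (a * b).
Proof.
move=> /convergent_bound [r [M [r0 _ M0 h]]] /convergent_bound [s [N [s0 _ N0 k]]].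
set t := Num.min r s.
have t0 : 0 < t by rewrite lt_min r0 s0.
have tr : t <= r by rewrite ge_min lexx.
have ts : t <= s by rewrite ge_min lexx orbT.
(* Halving the radius leaves a factor [2^-1 ^+ mdeg be] in each term of the product, so the growing
   number of terms is harmless. *)
apply/convergentP; exists (t / 2), (M * N * 2 ^+ n); split=> [|al]; first by rewrite divr_gt0.
have p0 m : 0 <= (t / 2) ^+ m by rewrite exprn_ge0 // divr_ge0 // ltW.
rewrite psME; apply: (@le_trans _ _ (\sum_(be <- below al) M * N * 2^-1 ^+ mdeg be)).
  apply: le_trans (ler_wpM2r (p0 _) (cnorm_sum _ _ _)) _.
  rewrite mulr_suml big_seq [leRHS]big_seq; apply: ler_sum => be; rewrite mem_below => hb.
  have -> : (t / 2) ^+ mdeg al =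
      (t / 2) ^+ mdeg (msub al be) * (t ^+ mdeg be * 2^-1 ^+ mdeg be).
    by rewrite -expr_half -exprD -mdegD msubK.
  rewrite cnormM.
  rewrite [leLHS](_ : _ = (cnorm (b (msub al be)) * (t / 2) ^+ mdeg (msub al be))
                       * (cnorm (a be) * t ^+ mdeg be) * 2^-1 ^+ mdeg be); last by ring.
  apply: ler_wpM2r; first by rewrite exprn_ge0 // invr_ge0.
  rewrite mulrC; apply: ler_pM; rewrite ?mulr_ge0 ?cnorm_ge0 ?exprn_ge0 ?divr_ge0 ?(ltW t0) //.
    by apply: h; rewrite // ltW.
  by apply: k; [rewrite divr_ge0 // ltW | lra].
rewrite -mulr_sumr ler_wpM2l ?mulr_ge0 //; exact: geometric_below.
Qed.

Lemma convergent_mono (be : mindex n) : convergent (ps_mono R be).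
Proof.
apply/convergentP; exists 1, 1; split=> // al; rewrite expr1n mulr1 cnorm_nat.
by case: (_ == _).
Qed.

Lemma convergent1 : convergent (1 : ps).
Proof. exact: convergent_mono. Qed.

Definition cst (z : R[i]) : ps := ps_scale z 1.

Lemma coef_cst z al : cst z al = if al == mzero n then z else 0.
Proof. by rewrite /cst /ps_scale /GRing.one /= /ps_mono; case: eqP; rewrite ?mulr1 ?mulr0. Qed.

Lemma coef_cstM z a al : (cst z * a) al = z * a al.
Proof.
transitivity (z * (1 * a) al); last by rewrite mul1r.
by rewrite !psME mulr_sumr; apply: eq_bigr => be _; rewrite mulrA.
Qed.

Lemma ps_scaleE z a : ps_scale z a = cst z * a.
Proof. by apply/funext => al; rewrite coef_cstM. Qed.

Lemma convergent_cst z : convergent (cst z).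
Proof.
apply/convergentP; exists 1, (cnorm z); split=> // al; rewrite expr1n mulr1 coef_cst.
by case: ifP; rewrite ?cnorm0 ?cnorm_ge0.
Qed.

Lemma cstD x y : cst (x + y) = cst x + cst y.
Proof. by apply/funext => al; rewrite psDE !coef_cst; case: ifP; rewrite ?addr0. Qed.

Lemma cstM x y : cst (x * y) = cst x * cst y.
Proof. by apply/funext => al; rewrite coef_cstM !coef_cst; case: ifP; rewrite ?mulr0. Qed.

Lemma cstN x : cst (- x) = - cst x.
Proof. by apply/funext => al; rewrite psNE !coef_cst; case: ifP; rewrite ?oppr0. Qed.

Lemma cst0 : cst 0 = 0.
Proof. by apply/funext => al; rewrite coef_cst; case: ifP. Qed.

Lemma cst1 : cst 1 = 1.
Proof. by apply/funext => al; rewrite /cst /ps_scale mul1r. Qed.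

Lemma convergent_var (i : 'I_n) : convergent (ps_var R i).
Proof. exact: convergent_mono. Qed.

Lemma convergent_deriv i a : convergent a -> convergent (ps_deriv i a).
Proof.
move=> /convergentP [r [M [r0 h]]]; apply/convergentP.
exists (r / 2), (M / r); split=> [|al]; first by rewrite divr_gt0.
have := h (madd al (munit i)); rewrite mdegD mdeg_unit addn1 exprSr => hal.
rewrite /ps_deriv cnormM cnorm_nat expr_half ler_pdivlMr //.
(* The halved radius absorbs the factor produced by differentiation. *)
have k1 : ((al i).+1%:R : R) * 2^-1 ^+ mdeg al <= 1.
  rewrite exprVn ler_pdivrMr ?exprn_gt0 // mul1r -natrX ler_nat.
  exact: leq_ltn_trans (leq_mdeg al i) (ltn_expl _ _).
have k0 : 0 <= cnorm (a (madd al (munit i))) * (r ^+ mdeg al * r).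
  by rewrite !mulr_ge0 ?cnorm_ge0 ?exprn_ge0 // ltW.
apply: le_trans hal; rewrite -[leRHS]mul1r.
rewrite [leLHS](_ : _ = (al i).+1%:R * 2^-1 ^+ mdeg al *
  (cnorm (a (madd al (munit i))) * (r ^+ mdeg al * r))); last by ring.
by apply: ler_wpM2r.
Qed.

End Convergence.

(** * Grauert division *)

Section InitialExponent.
Local Open Scope nat_scope.

(* The number with base-[N] digits [F]; once [N] exceeds all digits, comparing
   these numbers is comparing the digits lexicographically, whatever [N]. *)
Definition kappa n (N : nat) (F : 'I_n -> nat) := \sum_(j < n) F j * N ^ j.

Lemma kappa_lt n N (F : 'I_n -> nat) : (forall j, F j < N) -> kappa N F < N ^ n.
Proof.
elim: n F => [|n IH] F h; first by rewrite /kappa big_ord0.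
have := IH (fun j => F (widen_ord (leqnSn n) j)) (fun j => h _).
move: (h ord_max); rewrite /kappa big_ord_recr /= expnS.
move: (\sum_(_ < n) _) (N ^ n) (F _) => x y z.
by nia.
Qed.

(** The last digit is the most significant: if it differs, it decides the comparison in either base;
    if not, it is dropped and induction applies. *)
Lemma kappa_lex n N N' (F G : 'I_n -> nat) :
  (forall j, F j < N) -> (forall j, G j < N) -> N <= N' ->
  kappa N F < kappa N G -> kappa N' F < kappa N' G.
Proof.
elim: n F G => [|n IH] F G hF hG NN; first by rewrite /kappa !big_ord0.
pose w j := widen_ord (leqnSn n) j.
have := kappa_lt (fun j => hG (w j)).
have := @kappa_lt n N' (fun j => F (w j)) (fun j => leq_trans (hF (w j)) NN).
have := IH (fun j => F (w j)) (fun j => G (w j)) (fun j => hF _) (fun j => hG _) NN.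
rewrite /kappa !big_ord_recr /= -/w.
move: (\sum_(_ < n) _) (\sum_(_ < n) _) (\sum_(_ < n) _) (\sum_(_ < n) _) => x y z t.
move: (F _) (G _) (N ^ n) (N' ^ n) => f g P Q h1 h2 h3 h4.
have [lt|gt|e] := ltngtP f g; [nia|nia|].
by move: h4; rewrite e !ltn_add2r.
Qed.

Lemma kappa_inj n N (F G : 'I_n -> nat) :
  (forall j, F j < N) -> (forall j, G j < N) -> kappa N F = kappa N G -> F =1 G.
Proof.
elim: n F G => [|n IH] F G hF hG; first by move=> _ [].
pose w j := widen_ord (leqnSn n) j.
have := kappa_lt (fun j => hG (w j)); have := kappa_lt (fun j => hF (w j)).
have := IH (fun j => F (w j)) (fun j => G (w j)) (fun j => hF _) (fun j => hG _).
rewrite /kappa !big_ord_recr /= -/w.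
move: (\sum_(_ < n) _) (\sum_(_ < n) _) => x y h1 h2 h3 h4.
have e : F ord_max = G ord_max.
  by move: (F _) (G _) (N ^ n) h2 h3 h4 => f g P h2 h3 h4; nia.
rewrite e in h4; move/addIn: h4 => /h1 h j.
have [k ->|-> //] := unliftP ord_max j.
have -> : lift ord_max k = w k by apply: val_inj; rewrite /= /bump leqNgt ltn_ord.
exact: h.
Qed.

Lemma exists_min (T : Type) (P : T -> Prop) (phi : T -> nat) x : P x ->
  exists2 y, P y & forall z, P z -> phi y <= phi z.
Proof.
move: {2}(phi x) (leqnn (phi x)) => k; elim: k x => [|k IH] x xk Px.
  by exists x => // z _; move: xk; rewrite leqn0 => /eqP ->.
have [[z Pz zk]|h] := pselect (exists2 z, P z & phi z <= k); first exact: IH zk Pz.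
exists x => // z Pz; apply: leq_trans xk _; rewrite ltnNge; apply/negP => zk.
by apply: h; exists z.
Qed.

Variables (R : realType) (n : nat).
Implicit Types (a : ps R n).

(** The smallest exponent for the order by degree, then lexicographic from the last coordinate.
    Quantifying over all large bases [N] lets one base serve several series at once. *)
Definition is_init a (b : mindex n) := a b <> 0%R /\
  forall d, a d <> 0%R -> d <> b -> mdeg b < mdeg d \/
    (mdeg b = mdeg d /\ forall N, mdeg b < N -> kappa N b < kappa N d).

Lemma exists_init a : a <> 0%R -> exists b, is_init a b.
Proof.
move=> a0; have [b0 hb0] : exists b, a b <> 0%R.
  apply: contrapT => h; apply: a0; apply/funext => b.
  by apply: contrapT => hb; apply: h; exists b.
(* First the degree is minimised, then [kappa] among exponents of that degree; the base
   [(mdeg b1).+1] exceeds all their digits. *)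
have [b1 hb1 min1] := @exists_min _ (fun b => a b <> 0%R) (fun b => mdeg b) b0 hb0.
have [b [hb eb] min] := @exists_min _ (fun b => a b <> 0%R /\ mdeg b = mdeg b1)
  (fun b => kappa (mdeg b1).+1 b) b1 (conj hb1 erefl).
exists b; split=> // d hd db; rewrite eb.
move: (min1 d hd); rewrite leq_eqVlt => /orP [/eqP e|]; [right|by left].
split=> // N hN.
have dig (c : mindex n) : mdeg c = mdeg b1 -> forall j, c j < (mdeg b1).+1.
  by move=> ec j; rewrite ltnS -ec leq_mdeg.
apply: (kappa_lex (dig b eb) (dig d (esym e)) hN).
rewrite ltn_neqAle min ?andbT //; apply/eqP => /(kappa_inj (dig b eb) (dig d (esym e))) h.
by apply: db; apply/ffunP => j; rewrite h.
Qed.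

(* A linear weight that is minimal exactly at the initial exponent, for every
   series whose initial exponent has degree less than [N]. *)
Definition weight N (al : mindex n) := N ^ n * mdeg al + kappa N al.

Lemma weightD N al be : weight N (madd al be) = weight N al + weight N be.
Proof.
rewrite /weight mdegD mulnDr /kappa.
under eq_bigr => j _ do rewrite maddE mulnDl.
by rewrite big_split /= addnACA.
Qed.

Lemma mdeg_le_weight N al : 0 < N -> mdeg al <= weight N al.
Proof.
by move=> N0; apply: leq_trans (leq_addr _ _); rewrite leq_pmull // expn_gt0 N0.
Qed.

Lemma weight_le N al : 0 < N -> weight N al <= (N ^ n).*2 * mdeg al.
Proof.
move=> N0; rewrite /weight -addnn mulnDl leq_add2l /kappa /mdeg big_distrr /=.
by apply: leq_sum => j _; rewrite mulnC leq_mul2r leq_pexp2l ?orbT // ltnW.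
Qed.

(** A higher degree gains at least [N ^ n], more than [kappa N b] can amount to; in equal degree
    [kappa] decides. *)
Lemma weight_init N a b d : is_init a b -> mdeg b < N -> a d <> 0%R -> d <> b ->
  weight N b < weight N d.
Proof.
move=> [_ h] bN ad db; rewrite /weight.
have [lt|[e /(_ N bN) lt]] := h d ad db; last by rewrite e ltn_add2l.
have := @kappa_lt n N b (fun j => leq_ltn_trans (leq_mdeg b j) bN).
by move: lt; move: (kappa _ _) (kappa _ _) (mdeg _) (mdeg _) (N ^ n) => x y z t P; nia.
Qed.

End InitialExponent.

(** * Division with remainder in weighted norms *)

Section Division.
Variables (R : realType) (n : nat).
Notation ps := (ps R n).
Variables (wt : mindex n -> nat) (wc : nat).
Hypothesis wtD : forall al be, wt (madd al be) = (wt al + wt be)%N.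
Hypothesis deg_wt : forall al, (mdeg al <= wt al)%N.
Hypothesis wt_deg : forall al, (wt al <= wc * mdeg al)%N.

(** Iterating [F] from 0, the coefficient at [be] no longer changes after [(wt be).+1] steps. *)
Lemma causal_fixpoint (F : ps -> ps) :
  (forall be u v, (forall ga, (wt ga < wt be)%N -> u ga = v ga) -> F u be = F v be) ->
  exists u, u = F u.
Proof.
move=> caus; pose U k := iter k F 0.
have stab k be : (wt be < k)%N -> U k.+1 be = U k be.
  elim: k be => // k IH be hk; apply: (caus be (U k.+1) (U k)) => ga hga.
  exact: (IH ga (leq_trans hga hk)).
have stab' k l be : (wt be < k)%N -> (k <= l)%N -> U l be = U k be.
  move=> hk; elim: l => [|l IH]; first by rewrite leqn0 => /eqP ->.
  rewrite leq_eqVlt => /orP [/eqP -> //|kl].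
  by rewrite stab ?IH //; exact: leq_trans hk kl.
exists (fun be => U (wt be).+1 be); apply/funext => be.
apply: caus => ga hga; exact: stab'.
Qed.

(** All terms of [tau] have weight at least [m.+1], so its weighted norm is of order [t ^+ m.+1],
    which is below [e * t ^+ m] for small [t]. *)
Lemma small_tail (tau : ps) m (e : R) : convergent tau -> 0 < e ->
  (forall d, tau d <> 0 -> (m < wt d)%N) ->
  exists2 t1 : R, 0 < t1 & forall t, 0 < t -> t <= t1 ->
    forall be, \sum_(d <- below be) cnorm (tau d) * t ^+ wt d <= e * t ^+ m.
Proof.
move=> /convergent_bound [r [M [r0 r1 M0 h]]] e0 htau.
set t0 := r / 2; have t00 : 0 < t0 by rewrite divr_gt0.
have t01 : t0 <= 1 by rewrite /t0; lra.
set K := M * 2 ^+ n.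
have K0 : 0 <= K by rewrite mulr_ge0 // exprn_ge0.
have K1 : 0 < K + 1 by lra.
(* Writing [t = t0 * x], the sum is at most [K * x ^+ m.+1], so [K * x <= e * t0 ^+ m] is what is
   wanted. Dividing by [K + 1] covers the case [K = 0]. *)
exists (Num.min t0 (t0 * (e * t0 ^+ m / (K + 1)))).
  by rewrite lt_min t00 !mulr_gt0 ?invr_gt0 ?exprn_gt0.
move=> t tt0; rewrite le_min => /andP [tlet0 tle be].
set x := t / t0.
have tE : t = t0 * x by rewrite /x mulrC divfK // gt_eqF.
have x0 : 0 < x by rewrite divr_gt0.
have x1 : x <= 1 by rewrite /x ler_pdivrMr // mul1r.
have xK : K * x <= e * t0 ^+ m.
  apply: (@le_trans _ _ ((K + 1) * x)); first by rewrite ler_wpM2r ?(ltW x0) //; lra.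
  rewrite mulrC -ler_pdivlMr // /x ler_pdivrMr // mulrC; exact: tle.
clearbody x.
apply: (@le_trans _ _ (\sum_(d <- below be) (M * x ^+ m.+1) * 2^-1 ^+ mdeg d)).
  apply: ler_sum => d _.
  have [->|/eqP hd] := eqVneq (tau d) 0.
    by rewrite cnorm0 mul0r !mulr_ge0 ?exprn_ge0 ?invr_ge0 // ltW.
  rewrite tE exprMn.
  have e1 : t0 ^+ wt d <= t0 ^+ mdeg d by apply: ler_wiXn2l; rewrite ?(ltW t00).
  have e2 : x ^+ wt d <= x ^+ m.+1 by apply: ler_wiXn2l; rewrite ?(ltW x0) ?htau.
  apply: (@le_trans _ _ (cnorm (tau d) * (t0 ^+ mdeg d * x ^+ m.+1))).
    by rewrite ler_wpM2l ?cnorm_ge0 // ler_pM ?exprn_ge0 ?(ltW x0) ?(ltW t00).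
  rewrite /t0 expr_half.
  rewrite [leLHS](_ : _ = cnorm (tau d) * r ^+ mdeg d * (x ^+ m.+1 * 2^-1 ^+ mdeg d)); last by ring.
  rewrite -[leRHS]mulrA; apply: ler_wpM2r; last by apply: h; rewrite // ltW.
  by rewrite mulr_ge0 ?exprn_ge0 ?invr_ge0 // ltW.
rewrite -mulr_sumr; apply: (@le_trans _ _ (M * x ^+ m.+1 * 2 ^+ n)).
  by rewrite ler_wpM2l ?geometric_below // mulr_ge0 ?exprn_ge0 // ltW.
rewrite tE exprMn exprS [leLHS](_ : _ = K * x * x ^+ m); last by rewrite /K; ring.
by rewrite mulrA ler_wpM2r ?exprn_ge0 // ltW.
Qed.

Lemma common_radius (s : nat) (P : 'I_s -> R -> Prop) :
  (forall i, exists2 t1 : R, 0 < t1 & forall t, 0 < t -> t <= t1 -> P i t) ->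
  exists2 t1 : R, 0 < t1 & forall t, 0 < t -> t <= t1 -> forall i, P i t.
Proof.
move=> h; suff [t1 t10 k] : exists2 t1 : R, 0 < t1 &
    forall t, 0 < t -> t <= t1 -> forall i, i \in enum 'I_s -> P i t.
  by exists t1 => // t t0 tt1 i; apply: k => //; rewrite mem_enum.
elim: (enum _) => [|i l [t1 t10 k]]; first by exists 1.
have [t2 t20 k2] := h i; exists (Num.min t1 t2); first by rewrite lt_min t10.
move=> t t0; rewrite le_min => /andP [h1 h2] j; rewrite inE => /orP [/eqP ->|/k]; auto.
Qed.

Lemma weighted_bound (a : ps) : convergent a ->
  exists2 M : R, 0 <= M & exists2 t1 : R, 0 < t1 /\ t1 <= 1 & forall t, 0 < t -> t <= t1 ->
    forall al, cnorm (a al) * t ^+ wt al <= M.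
Proof.
move=> /convergent_bound [r [M [r0 r1 M0 h]]]; exists M => //; exists r => // t t0 tr al.
apply: le_trans (h t al (ltW t0) tr); rewrite ler_wpM2l ?cnorm_ge0 //.
by apply: ler_wiXn2l; rewrite ?(ltW t0) ?(le_trans tr).
Qed.

(** Weights are at most [wc] times the degree, so the weighted estimate at [t] is a Cauchy estimate
    at radius [t ^+ wc]. *)
Lemma convergent_weighted (a : ps) (t M : R) : 0 < t -> t <= 1 ->
  (forall al, cnorm (a al) * t ^+ wt al <= M) -> convergent a.
Proof.
move=> t0 t1 h; apply/convergentP; exists (t ^+ wc), M; split=> [|al]; first by rewrite exprn_gt0.
apply: le_trans (h al); rewrite ler_wpM2l ?cnorm_ge0 // -exprM.
by apply: ler_wiXn2l; rewrite ?(ltW t0).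
Qed.

Variables (s : nat) (b : 'I_s -> mindex n) (g : 'I_s -> ps).
Hypothesis g_conv : forall i, convergent (g i).
Hypothesis g_monic : forall i, g i (b i) = 1.
Hypothesis g_init : forall i d, g i d <> 0 -> d <> b i -> (wt (b i) < wt d)%N.

Let tau i : ps := g i - ps_mono R (b i).

Let tau_wt i d : tau i d <> 0 -> (wt (b i) < wt d)%N.
Proof.
rewrite /tau psDE psNE /ps_mono; have [->|/eqP db] := eqVneq d (b i).
  by rewrite g_monic subrr.
by rewrite subr0 => /g_init; apply.
Qed.

(** An exponent may be divisible by several [b i]; choosing one of them splits a series into
    disjoint pieces. *)
Let sel (al : mindex n) : option 'I_s := [pick i | mle (b i) al].

Let quo (u : ps) i : ps := fun al =>
  if sel (madd al (b i)) == Some i then u (madd al (b i)) else 0.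

(** At a fixpoint [u] equals [a] minus the tails times the quotients. Since [u] is also the sum of
    the monomials at [b i] times the quotients and of the remainder, [a] is recovered with divisors
    [g i]. *)
Let step (a u : ps) : ps := a - \sum_i tau i * quo u i.

Let stepE a u be : step a u be =
  a be - \sum_i \sum_(d <- below be) tau i d * quo u i (msub be d).
Proof.
by rewrite /step psDE psNE ps_sumE; congr (_ - _); apply: eq_bigr => i _; rewrite psME.
Qed.

Let shifted_wt i be d : mle d be ->
  (wt (madd (msub be d) (b i)) + wt d = wt be + wt (b i))%N.
Proof. by move=> h; rewrite wtD addnAC -wtD msubK. Qed.

(* [u] solves the fixpoint equation of the division algorithm; the coefficients
   are bounded by induction on the weight since the tails [tau i] are small for
   the norms [t ^+ wt]. *)
Lemma weighted_division (a : ps) : convergent a ->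
  exists q : 'I_s -> ps, exists2 rho : ps, (forall i, convergent (q i)) &
    a = \sum_i q i * g i + rho /\ forall al i, mle (b i) al -> rho al = 0.
Proof.
move=> ca.
have [u uE] : exists u, u = step a u.
  (* Every term of [tau i] is heavier than [b i], so the coefficient of [u] that it multiplies has
     weight below [wt be]. *)
  apply: causal_fixpoint => be u v h; rewrite !stepE; congr (_ - _).
  apply: eq_bigr => i _; rewrite big_seq [RHS]big_seq; apply: eq_bigr => d; rewrite mem_below => db.
  have [->|/eqP /tau_wt hd] := eqVneq (tau i d) 0; first by rewrite !mul0r.
  rewrite /quo; case: ifP => // _; rewrite h //.
  by move: (shifted_wt i db); lia.
have [M M0 [ta [ta0 ta1] ha]] := weighted_bound ca.
(* With this [e] the [s] tails together contribute at most [s * (2 * M * e) <= M], which keeps the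
   bound [2 * M] through the induction. *)
pose e : R := (2 * s.+1%:R)^-1.
have e0 : 0 < e by rewrite invr_gt0 mulr_gt0 ?ltr0n.
have [tg tg0 hg] := @common_radius s _ (fun i =>
  small_tail (convergentB (g_conv i) (convergent_mono R (b i))) e0 (@tau_wt i)).
pose t := Num.min ta tg.
have t0 : 0 < t by rewrite lt_min ta0.
have tta : t <= ta by rewrite ge_min lexx.
have ttg : t <= tg by rewrite ge_min lexx orbT.
have t1 : t <= 1 by apply: le_trans ta1.
have tp k : 0 < t ^+ k by rewrite exprn_gt0.
have bound al : cnorm (u al) * t ^+ wt al <= 2 * M.
  move: {2}(wt al).+1 (ltnSn (wt al)) => k; elim: k al => // k IH be; rewrite ltnS => bek.
  rewrite uE stepE; apply: (@le_trans _ _ ((cnorm (a be) + \sum_i \sum_(d <- below be)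
      cnorm (tau i d) * cnorm (quo u i (msub be d))) * t ^+ wt be)).
    rewrite ler_wpM2r ?(ltW (tp _)) //; apply: le_trans (cnormD _ _) _; rewrite lerD2l cnormN.
    apply: le_trans (cnorm_sum _ _ _) _; apply: ler_sum => i _.
    apply: le_trans (cnorm_sum _ _ _) _; apply: ler_sum => d _.
    by rewrite cnormM.
  rewrite mulrDl mulr_suml; apply: (@le_trans _ _ (M + \sum_(i < s) 2 * M * e)); last first.
    rewrite sumr_const card_ord -[X in _ + X]mulr_natr.
    have : e * s.+1%:R * 2 = 1.
      by rewrite /e -mulrA [_ * 2]mulrC mulVf // mulf_neq0 ?pnatr_eq0.
    rewrite -natr1; move: (s%:R) e0 => S ee h.
    have : M * e * 2 + 2 * M * e * S = M.
      by transitivity (M * (e * (S + 1) * 2)); [ring | rewrite h mulr1].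
    have : 0 <= M * e by rewrite mulr_ge0 // ltW.
    by lra.
  apply: lerD; first exact: ha.
  apply: ler_sum => i _; rewrite mulr_suml.
  apply: (@le_trans _ _ (\sum_(d <- below be)
      2 * M / t ^+ wt (b i) * (cnorm (tau i d) * t ^+ wt d))).
    rewrite big_seq [leRHS]big_seq; apply: ler_sum => d; rewrite mem_below => db.
    have [->|/eqP /tau_wt hd] := eqVneq (tau i d) 0; first by rewrite cnorm0 !(mul0r,mulr0).
    rewrite [leLHS](_ : _ = cnorm (quo u i (msub be d)) * t ^+ wt be * cnorm (tau i d));
      last by ring.
    rewrite [leRHS](_ : _ = 2 * M / t ^+ wt (b i) * t ^+ wt d * cnorm (tau i d)); last by ring.
    apply: ler_wpM2r; rewrite ?cnorm_ge0 // mulrAC ler_pdivlMr //.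
    rewrite /quo; case: ifP => _; last first.
      by rewrite cnorm0 !mul0r !mulr_ge0 // ltW.
    rewrite -mulrA -exprD -(shifted_wt i db) exprD mulrA ler_wpM2r ?(ltW (tp _)) //.
    by apply: IH; move: (shifted_wt i db); lia.
  rewrite -mulr_sumr; apply: le_trans (ler_wpM2l _ (hg t t0 ttg i be)) _.
    by rewrite !mulr_ge0 ?invr_ge0 // ltW.
  by rewrite [leLHS](_ : _ = 2 * M * e) //; field; rewrite gt_eqF.
exists (quo u), (fun al => if sel al is Some _ then 0 else u al).
  move=> i; apply: (@convergent_weighted _ t (2 * M / t ^+ wt (b i))) => // al.
  rewrite /quo; case: ifP => _; last by rewrite cnorm0 mul0r !mulr_ge0 ?invr_ge0 // ltW.
  by rewrite ler_pdivlMr // -mulrA -exprD -wtD.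
split; last first.
  by move=> al i h; rewrite /sel; case: pickP => // /(_ i); rewrite h.
have -> : a = u + \sum_i tau i * quo u i by rewrite {1}uE /step subrK.
have -> : \sum_i quo u i * g i =
    \sum_i tau i * quo u i + \sum_i ps_mono R (b i) * quo u i.
  by rewrite -big_split; apply: eq_bigr => i _; rewrite /tau /=; ring.
rewrite addrC -addrA; congr (_ + _); apply/funext => al; rewrite psDE ps_sumE.
have E i : (ps_mono R (b i) * quo u i) al = if sel al == Some i then u al else 0.
  rewrite [LHS]ps_mul_mono; case: ifP => h; first by rewrite /quo msubK.
  by rewrite /sel; case: pickP => // j hj; case: eqP => // -[ji]; rewrite -ji hj in h.
under eq_bigr do rewrite E.
case: (sel al) => [i|]; last by rewrite big1 ?add0r.
rewrite addr0 (bigD1 i) //= eqxx big1 ?addr0 // => j ji.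
by case: eqP => // -[ij]; rewrite ij eqxx in ji.
Qed.

End Division.

(** * Closed ideals and vector fields *)

Section Orders.
Variables (R : realType) (n : nat).
Notation ps := (ps R n).
Implicit Types a b c : ps.

Definition ord_ge k a := forall al, (mdeg al < k)%N -> a al = 0.

Lemma ord_ge0 a : ord_ge 0 a. Proof. by []. Qed.

Lemma ord_geW j k a : (j <= k)%N -> ord_ge k a -> ord_ge j a.
Proof. by move=> jk h al hal; apply: h; apply: leq_trans jk. Qed.

Lemma ord_geD k a b : ord_ge k a -> ord_ge k b -> ord_ge k (a + b).
Proof. by move=> ha hb al hal; rewrite psDE ha ?hb ?addr0. Qed.

Lemma ord_geN k a : ord_ge k a -> ord_ge k (- a).
Proof. by move=> ha al hal; rewrite psNE ha ?oppr0. Qed.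

Lemma ord_geB k a b : ord_ge k a -> ord_ge k b -> ord_ge k (a - b).
Proof. by move=> ha hb; apply: ord_geD => //; apply: ord_geN. Qed.

Lemma ord_geM j k a b : ord_ge j a -> ord_ge k b -> ord_ge (j + k) (a * b).
Proof.
move=> ha hb al hal; rewrite psME big_seq big1 // => be; rewrite mem_below => h.
have [lt|ge] := ltnP (mdeg be) j; first by rewrite ha ?mul0r.
by rewrite hb ?mulr0 //; move: hal; rewrite -{1}(msubK h) mdegD; lia.
Qed.

Lemma ord_geMl k a b : ord_ge k b -> ord_ge k (a * b).
Proof. exact: ord_geM (@ord_ge0 a). Qed.

Lemma ord_ge_sum k (I : Type) (r : seq I) (P : pred I) (F : I -> ps) :
  (forall i, P i -> ord_ge k (F i)) -> ord_ge k (\sum_(i <- r | P i) F i).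
Proof. by move=> h; apply: big_ind => //; apply: ord_geD. Qed.

Lemma ord_ge1P a : ord_ge 1 a <-> a (mzero n) = 0.
Proof.
split=> [|h al]; first by apply; rewrite mdeg0.
by rewrite ltnS leqn0 mdeg_eq0 => /eqP ->.
Qed.

Lemma ord_ge_mono (be : mindex n) : ord_ge (mdeg be) (ps_mono R be).
Proof. by move=> al; rewrite /ps_mono; case: eqP => // ->; rewrite ltnn. Qed.

Lemma ord_ge_var (i : 'I_n) : ord_ge 1 (ps_var R i).
Proof. by have := @ord_ge_mono (munit i); rewrite mdeg_unit. Qed.

(** Each nonconstant monomial is assigned to one variable that occurs in it, and only the quotient
    by that variable retains it. This makes the decomposition in [hadamard] exact. *)
Definition divx (i : 'I_n) a : ps := fun al =>
  if [pick j | (0 < madd al (munit i) j)%N] == Some i then a (madd al (munit i)) else 0.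

Lemma mle_unit i (al : mindex n) : mle (munit i) al = (0 < al i)%N.
Proof.
apply/mleP/idP => [/(_ i)|h j]; first by rewrite munitE eqxx.
by rewrite munitE; case: eqP => // ->.
Qed.

Lemma coef_varM i a al :
  (ps_var R i * a) al = if (0 < al i)%N then a (msub al (munit i)) else 0.
Proof. by rewrite [LHS]ps_mul_mono mle_unit. Qed.

Lemma hadamard a : a = cst (a (mzero n)) + \sum_i ps_var R i * divx i a.
Proof.
apply/funext => al; rewrite psDE ps_sumE coef_cst.
have E i : (ps_var R i * divx i a) al =
    if [pick j | (0 < al j)%N] == Some i then a al else 0.
  rewrite coef_varM; case: ifP => h; first by rewrite /divx msubK ?mle_unit.
  by case: pickP => // j hj; case: eqP => // -[ji]; rewrite -ji hj in h.
under eq_bigr do rewrite E.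
have [->|ne] := eqVneq al (mzero n).
  by case: pickP => [j|_]; rewrite ?ffunE // big1 // addr0.
rewrite add0r; case: pickP => [i _|h].
  rewrite (bigD1 i) //= eqxx big1 ?addr0 // => j ji.
  by case: eqP => // -[ij]; rewrite ij eqxx in ji.
case/eqP: ne; apply/ffunP => j; move: (h j); rewrite ffunE; by case: (al j).
Qed.

Lemma ord_ge_divx i k a : ord_ge k.+1 a -> ord_ge k (divx i a).
Proof.
move=> h al hal; rewrite /divx; case: ifP => // _; apply: h.
by rewrite mdegD mdeg_unit addn1.
Qed.

Lemma convergent_divx i a : convergent a -> convergent (divx i a).
Proof.
move=> /convergentP [r [M [r0 h]]]; apply/convergentP; exists r, (M / r); split=> // al.
have M0 : 0 <= M by apply: le_trans (h (mzero n)); rewrite mulr_ge0 ?cnorm_ge0 ?exprn_ge0 // ltW.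
rewrite /divx; case: ifP => _; last by rewrite cnorm0 mul0r divr_ge0 // ltW.
by rewrite ler_pdivlMr // -mulrA -exprSr -addn1 -(mdeg_unit i) -mdegD.
Qed.

End Orders.

(** * Ideals of convergent series and their closedness *)

Section Krull.
Variables (R : realType) (n : nat).
Notation ps := (ps R n).
Implicit Types a b c : ps.

Section Ideal.
Variables (K : finType) (G : K -> ps).

(** The type [ps] holds all formal series, so convergent coefficients are demanded to obtain ideals
    of the ring of convergent ones. *)
Definition in_ideal a := exists2 h : K -> ps, (forall i, convergent (h i)) & a = \sum_i h i * G i.

Lemma ideal0 : in_ideal 0.
Proof.
exists (fun=> 0) => [i|]; first exact: convergent0.
by rewrite big1 // => i _; rewrite mul0r.
Qed.

Lemma idealD a b : in_ideal a -> in_ideal b -> in_ideal (a + b).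
Proof.
move=> [h ch ->] [k ck ->]; exists (fun i => h i + k i) => [i|]; first exact: convergentD.
by rewrite -big_split; apply: eq_bigr => i _; rewrite mulrDl.
Qed.

Lemma idealM c a : convergent c -> in_ideal a -> in_ideal (c * a).
Proof.
move=> cc [h ch ->]; exists (fun i => c * h i) => [i|]; first exact: convergentM.
by rewrite mulr_sumr; apply: eq_bigr => i _; rewrite mulrA.
Qed.

Lemma idealN a : in_ideal a -> in_ideal (- a).
Proof. by rewrite -mulN1r; apply: idealM; apply: convergentN; apply: convergent1. Qed.

Lemma idealB a b : in_ideal a -> in_ideal b -> in_ideal (a - b).
Proof. by move=> ha hb; apply: idealD => //; apply: idealN. Qed.

Lemma ideal_sum (I : Type) (r : seq I) (P : pred I) (F : I -> ps) :
  (forall i, P i -> in_ideal (F i)) -> in_ideal (\sum_(i <- r | P i) F i).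
Proof. by move=> h; apply: big_ind => //; [exact: ideal0 | exact: idealD]. Qed.

Lemma ideal_gen i : in_ideal (G i).
Proof.
exists (fun j => (j == i)%:R) => [j|].
  by case: (j == i); [exact: convergent1 | exact: convergent0].
rewrite (bigD1 i) //= eqxx mul1r big1 ?addr0 // => j /negPf ->.
by rewrite mul0r.
Qed.

Hypothesis G_conv : forall i, convergent (G i).

Lemma ideal_convergent a : in_ideal a -> convergent a.
Proof. by move=> [h ch ->]; apply: convergent_sum => i _; apply: convergentM. Qed.

(** Divide [a] by finitely many ideal elements whose initial exponents, by Dickson's lemma, divide
    those of all nonzero elements. A nonzero remainder would share its initial exponent with an
    ideal element, so that exponent would be divisible by a chosen one, which the division
    excludes. *)
Theorem ideal_closed a : convergent a ->
  (forall k, exists2 b, in_ideal b & ord_ge k (a - b)) -> in_ideal a.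
Proof.
move=> ca cl; pose S be := exists2 g, in_ideal g & is_init g be.
have [B BS Bmin] := dickson S.
(* This base exceeds the degrees of all chosen initial exponents, so a single weight singles out the
   initial term of every divisor. *)
pose N := (\max_(be <- B) mdeg be).+1.
pose b (i : 'I_(size B)) := nth (mzero n) B i.
have bB i : b i \in B by apply: mem_nth.
have bN i : (mdeg (b i) < N)%N by rewrite ltnS (big_rem _ (bB i)) leq_maxl.
have /choice [g hg] : forall i, exists g, in_ideal g /\ (g (b i) = 1 /\
    forall d, g d <> 0 -> d <> b i -> (weight N (b i) < weight N d)%N).
  move=> i; have [g ig gb] := BS _ (bB i).
  have g0 : g (b i) != 0 by apply/eqP; case: gb.
  exists (cst (g (b i))^-1 * g); split; first by apply: idealM => //; apply: convergent_cst.
  split=> [|d]; rewrite coef_cstM ?mulVf // => hd; apply: weight_init gb (bN i) _.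
  by move=> gd; apply: hd; rewrite gd mulr0.
have [q [rho qc [aE rho0]]] := @weighted_division R n (weight N) _ (@weightD n N)
  (fun al => mdeg_le_weight al (ltn0Sn _)) (fun al => weight_le al (ltn0Sn _)) _ b g
  (fun i => ideal_convergent (hg i).1) (fun i => (hg i).2.1) (fun i => (hg i).2.2) a ca.
have qi : in_ideal (\sum_i q i * g i).
  by apply: ideal_sum => i _; apply: idealM => //; case: (hg i).
suff r0 : rho = 0 by rewrite aE r0 addr0.
apply: contrapT => /exists_init [be rbe].
(* Agreement up to and including degree [mdeg be] is enough for [c'] to inherit the initial exponent
   of [rho]. *)
have [c ic hc] := cl (mdeg be).+1.
pose c' := c - \sum_i q i * g i.
have cE d : (mdeg d <= mdeg be)%N -> c' d = rho d.
  move=> hd; have : rho - c' = a - c by rewrite /c' aE; ring.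
  move/(congr1 (fun u : ps => u d)); rewrite hc // psDE psNE => /eqP.
  by rewrite subr_eq0 => /eqP.
have : S be.
  exists c'; first exact: idealB.
  move: rbe => [r1 r2]; split=> [|d c'd db]; first by rewrite cE.
  have [ge|] := leqP (mdeg d) (mdeg be); last by left.
  have rd : rho d <> 0 by rewrite -cE.
  by have := r2 d rd db; rewrite ltnNge ge.
move/Bmin => [be0 be0B le0]; case: rbe => rbe _; apply: rbe.
have [i lti ei] := (nthP (mzero n) be0B).
by apply: (rho0 _ (Ordinal lti)); rewrite /b /= ei.
Qed.

End Ideal.
End Krull.

(** * Partial derivatives and vector fields *)

Section Derivations.
Variables (R : realType) (n : nat).
Notation ps := (ps R n).
Implicit Types a b c : ps.

Definition theta (i : 'I_n) a : ps := fun al => (al i)%:R * a al.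

Lemma varM_inj (i : 'I_n) a b : ps_var R i * a = ps_var R i * b -> a = b.
Proof.
move=> e; apply/funext => al.
move/(congr1 (fun u : ps => u (madd al (munit i)))): e.
by rewrite !coef_varM maddK maddE munitE eqxx addn1.
Qed.

Lemma varM_deriv i a : ps_var R i * ps_deriv i a = theta i a.
Proof.
apply/funext => al; rewrite coef_varM /theta; case: ifP => h.
  rewrite /ps_deriv msubK ?mle_unit // msubE munitE eqxx subn1 prednK //.
by move: h; rewrite lt0n => /negbFE/eqP ->; rewrite mul0r.
Qed.

Lemma thetaM i a b : theta i (a * b) = theta i a * b + a * theta i b.
Proof.
apply/funext => al; rewrite psDE !psME /theta psME mulr_sumr -big_split.
rewrite big_seq [RHS]big_seq; apply: eq_bigr => be; rewrite mem_below => h /=.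
by rewrite -{1}(msubK h) maddE natrD; ring.
Qed.

Lemma ps_derivD i a b : ps_deriv i (a + b) = ps_deriv i a + ps_deriv i b.
Proof. by apply/funext => al; rewrite /ps_deriv !psDE mulrDr. Qed.

(* The Euler operators [theta i = x_i d/dx_i] are visibly derivations, and
   [x_i] can be cancelled. *)
Lemma ps_derivM i a b : ps_deriv i (a * b) = ps_deriv i a * b + a * ps_deriv i b.
Proof.
apply: (@varM_inj i); rewrite varM_deriv thetaM -!varM_deriv; ring.
Qed.

Lemma ps_deriv_cst i z : ps_deriv i (cst z : ps) = 0.
Proof.
apply/funext => al; rewrite /ps_deriv coef_cst -mdeg_eq0 mdegD mdeg_unit addn1.
by rewrite mulr0.
Qed.

Lemma ps_deriv0 i : ps_deriv i (0 : ps) = 0.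
Proof. by apply/funext => al; rewrite /ps_deriv !ps0E mulr0. Qed.

Lemma ps_derivN i a : ps_deriv i (- a) = - ps_deriv i a.
Proof. by apply/funext => al; rewrite /ps_deriv !psNE mulrN. Qed.

Lemma ps_deriv_sum i (I : Type) (r : seq I) (P : pred I) (F : I -> ps) :
  ps_deriv i (\sum_(j <- r | P j) F j) = \sum_(j <- r | P j) ps_deriv i (F j).
Proof. exact: (big_morph _ (@ps_derivD i) (@ps_deriv0 i)). Qed.

Lemma ps_derivC i j a : ps_deriv i (ps_deriv j a) = ps_deriv j (ps_deriv i a).
Proof.
have [->//|ij] := eqVneq i j; apply/funext => al.
rewrite /ps_deriv !maddE !munitE (negPf ij) eq_sym (negPf ij) !addn0.
by rewrite -!maddA (maddC (munit i)) mulrCA.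
Qed.

Lemma ps_deriv_var (i j : 'I_n) : ps_deriv i (ps_var R j) = (i == j)%:R.
Proof.
apply/funext => al; rewrite /ps_deriv /ps_var.
have -> : (madd al (munit i) == munit j) = (al == mzero n) && (i == j).
  apply/eqP/andP => [e|[/eqP -> /eqP ->]]; last by apply/ffunP => k; rewrite !ffunE.
  have a0 : al == mzero n.
    by rewrite -mdeg_eq0 -(eqn_add2r 1) -{1}(mdeg_unit i) -mdegD e mdeg_unit.
  split=> //; move/ffunP/(_ i): e; rewrite maddE !munitE eqxx addn1.
  by case: eqP.
case: (i == j); rewrite ?andbF ?mulr0 //= andbT [RHS]/(ps_mono _ _ _) /ps_mono.
by case: eqP => [->|_]; rewrite ?mulr0 // ffunE mulr1.
Qed.

Lemma ord_ge_deriv i k a : ord_ge k.+1 a -> ord_ge k (ps_deriv i a).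
Proof. by move=> h al hal; rewrite /ps_deriv h ?mulr0 // mdegD mdeg_unit addn1. Qed.

Section VectorField.
Variable g : 'I_n -> ps.

Definition vfield a := \sum_i g i * ps_deriv i a.

Lemma vfieldD a b : vfield (a + b) = vfield a + vfield b.
Proof. by rewrite -big_split; apply: eq_bigr => i _; rewrite ps_derivD mulrDr. Qed.

Lemma vfieldN a : vfield (- a) = - vfield a.
Proof. by rewrite -sumrN; apply: eq_bigr => i _; rewrite ps_derivN mulrN. Qed.

Lemma vfieldM a b : vfield (a * b) = vfield a * b + a * vfield b.
Proof.
rewrite /vfield mulr_suml mulr_sumr -big_split; apply: eq_bigr => i _.
by rewrite ps_derivM /=; ring.
Qed.

Lemma vfield_cst z : vfield (cst z) = 0.
Proof. by rewrite /vfield big1 // => i _; rewrite ps_deriv_cst mulr0. Qed.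

Lemma vfield0 : vfield 0 = 0.
Proof. by rewrite /vfield big1 // => i _; rewrite ps_deriv0 mulr0. Qed.

Lemma vfield_sum (I : Type) (r : seq I) (P : pred I) (F : I -> ps) :
  vfield (\sum_(j <- r | P j) F j) = \sum_(j <- r | P j) vfield (F j).
Proof. exact: (big_morph _ vfieldD vfield0). Qed.

Lemma vfield_var i : vfield (ps_var R i) = g i.
Proof.
rewrite /vfield (bigD1 i) //= ps_deriv_var eqxx mulr1 big1 ?addr0 // => j ji.
by rewrite ps_deriv_var (negPf ji) mulr0.
Qed.

(** Second derivatives cancel in the commutator of a partial derivative with a vector field; what
    remains is a combination of first derivatives. *)
Lemma deriv_vfield i a : ps_deriv i (vfield a) =
  vfield (ps_deriv i a) + \sum_j ps_deriv i (g j) * ps_deriv j a.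
Proof.
rewrite ps_deriv_sum -big_split; apply: eq_bigr => j _.
by rewrite ps_derivM addrC ps_derivC.
Qed.

Lemma convergent_vfield a : (forall i, convergent (g i)) -> convergent a -> convergent (vfield a).
Proof.
by move=> hg ca; apply: convergent_sum => i _; apply: convergentM => //; apply: convergent_deriv.
Qed.

Lemma ord_ge_vfield k a : (forall i, ord_ge 1 (g i)) -> ord_ge k a -> ord_ge k (vfield a).
Proof.
case: k => // k hg ha; apply: ord_ge_sum => i _; rewrite -add1n; apply: ord_geM => //.
exact: ord_ge_deriv.
Qed.

End VectorField.
End Derivations.

(** * Linear parts: series modulo the square of the maximal ideal *)

Section LinearParts.
Variables (R : realType) (n : nat).
Notation ps := (ps R n).
Implicit Types a b c : ps.

Definition lin a : 'rV[R[i]]_n := \row_j a (munit j).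

Lemma linD a b : lin (a + b) = lin a + lin b.
Proof. by apply/rowP => j; rewrite !mxE. Qed.

Lemma linN a : lin (- a) = - lin a.
Proof. by apply/rowP => j; rewrite !mxE. Qed.

Lemma lin_cstM z a : lin (cst z * a) = z *: lin a.
Proof. by apply/rowP => j; rewrite !mxE coef_cstM. Qed.

Lemma lin0 : lin 0 = 0.
Proof. by apply/rowP => j; rewrite !mxE. Qed.

Lemma lin_sum (I : Type) (r : seq I) (P : pred I) (F : I -> ps) :
  lin (\sum_(i <- r | P i) F i) = \sum_(i <- r | P i) lin (F i).
Proof. exact: (big_morph _ linD lin0). Qed.

Lemma ord_ge_sub_cst a : ord_ge 1 (a - cst (a (mzero n))).
Proof. by apply/ord_ge1P; rewrite psDE psNE coef_cst eqxx subrr. Qed.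

Lemma linM a b : ord_ge 1 b -> lin (a * b) = a (mzero n) *: lin b.
Proof.
move=> b1; rewrite -lin_cstM; apply/eqP; rewrite -subr_eq0 -linN -linD -mulrBl.
apply/eqP/rowP => j; rewrite !mxE; apply: (ord_geM (@ord_ge_sub_cst a) b1).
by rewrite mdeg_unit.
Qed.

Lemma mdeg1P (al : mindex n) : mdeg al = 1%N -> exists i, al = munit i.
Proof.
move=> d1; case: (pickP (fun i => 0 < al i)%N) => [i hi|h].
  exists i; apply/eqP; rewrite -[al](@msubK _ _ (munit i)) ?mle_unit //.
  have : mdeg (msub al (munit i)) == 0%N.
    by rewrite -(eqn_add2r 1) -{1}(mdeg_unit i) -mdegD msubK ?mle_unit ?d1.
  by rewrite mdeg_eq0 => /eqP ->; apply/eqP/ffunP => j; rewrite !ffunE.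
by move: d1; rewrite /mdeg big1 // => i _; move: (h i); case: (al i).
Qed.

Lemma ord_ge2P a : ord_ge 1 a -> lin a = 0 -> ord_ge 2 a.
Proof.
move=> a1 /rowP l0 al; rewrite ltnS leq_eqVlt => /orP [/eqP /mdeg1P [i ->]|]; last exact: a1.
by have := l0 i; rewrite !mxE.
Qed.

Lemma coef_deriv0 i a : ps_deriv i a (mzero n) = a (munit i).
Proof.
rewrite /ps_deriv ffunE mul1r; congr (a _).
by apply/ffunP => j; rewrite !ffunE.
Qed.

Lemma lin_vfield (g : 'I_n -> ps) a : (forall i, ord_ge 1 (g i)) ->
  lin (vfield g a) = lin a *m \matrix_i lin (g i).
Proof.
move=> g1; rewrite lin_sum mulmx_sum_row; apply: eq_bigr => i _.
by rewrite mulrC linM // coef_deriv0 mxE rowK.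
Qed.

End LinearParts.

(** * The spectrum of a vector field on jets *)

Section Spectrum.
Variables (R : realType) (n : nat) (g : 'I_n -> ps R n).
Notation ps := (ps R n).
Implicit Types a b c : ps.
Hypothesis g1 : forall i, ord_ge 1 (g i).
Notation eta := (vfield g).

Definition shift_op (z : R[i]) a : ps := eta a - cst z * a.
Definition shift_ops (s : seq R[i]) a : ps := foldr shift_op a s.

Lemma vfield_cstM z a : eta (cst z * a) = cst z * eta a.
Proof. by rewrite vfieldM vfield_cst mul0r add0r. Qed.

Lemma shift_opD z a b : shift_op z (a + b) = shift_op z a + shift_op z b.
Proof. by rewrite /shift_op vfieldD; ring. Qed.

Lemma shift_opsD s a b : shift_ops s (a + b) = shift_ops s a + shift_ops s b.
Proof. by elim: s => //= z s ->; rewrite shift_opD. Qed.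

Lemma shift_opC y z a : shift_op y (shift_op z a) = shift_op z (shift_op y a).
Proof. by rewrite /shift_op !vfieldD !vfieldN !vfield_cstM; ring. Qed.

Lemma shift_opsC s t a : shift_ops s (shift_ops t a) = shift_ops t (shift_ops s a).
Proof.
have C z u b : shift_op z (shift_ops u b) = shift_ops u (shift_op z b).
  by elim: u => //= y u IH; rewrite shift_opC IH.
by elim: s => //= z s IH; rewrite IH C.
Qed.

Lemma shift_ops_cat s t a : shift_ops (s ++ t) a = shift_ops s (shift_ops t a).
Proof. exact: foldr_cat. Qed.

Lemma ord_ge_shift_ops k s a : ord_ge k a -> ord_ge k (shift_ops s a).
Proof.
move=> h; elim: s => //= z s IH; apply: ord_geB; first exact: ord_ge_vfield.
exact: ord_geMl.
Qed.

(** A polynomial in [eta] with all roots in [P] sends [a] to order [k]. This expresses a bound on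
    the spectrum without bases or generalised eigenspaces. *)
Definition killed (P : pred R[i]) k a := exists2 s, all P s & ord_ge k (shift_ops s a).

Lemma killed_ord P k a : ord_ge k a -> killed P k a.
Proof. by exists [::]. Qed.

(** The operators commute, so the concatenated list works for both summands. *)
Lemma killedD P k a b : killed P k a -> killed P k b -> killed P k (a + b).
Proof.
move=> [s Ps hs] [t Pt ht]; exists (s ++ t); first by rewrite all_cat Ps.
rewrite shift_ops_cat !shift_opsD; apply: ord_geD; last exact: ord_ge_shift_ops.
by rewrite shift_opsC; apply: ord_ge_shift_ops.
Qed.

Lemma killed_sum P k (I : Type) (r : seq I) (Q : pred I) (F : I -> ps) :
  (forall i, Q i -> killed P k (F i)) -> killed P k (\sum_(i <- r | Q i) F i).
Proof.
by move=> h; apply: big_ind => //; [exact: killed_ord | exact: killedD].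
Qed.

Variables (L : finType) (l : L -> ps) (z : L -> R[i]).
Hypothesis l1 : forall q, ord_ge 1 (l q).
Hypothesis z0 : forall q, 0 < z q.
Hypothesis l_eigen : forall q, ord_ge 2 (eta (l q) - cst (z q) * l q).
Hypothesis l_span : forall i, exists c : L -> R[i],
  ord_ge 2 (ps_var R i - \sum_q cst (c q) * l q).

(** By the Leibniz rule, multiplying by the eigenvector [l q] shifts eigenvalues by [z q]; the error
    comes from [eta (l q) - z q * l q], which has order 2. *)
Lemma shift_ops_eigenM q j t b : ord_ge j b ->
  ord_ge j.+2 (shift_ops [seq y + z q | y <- t] (l q * b) - l q * shift_ops t b).
Proof.
move=> hb; elim: t => [|y t IH] /=; first by rewrite subrr.
have := ord_ge_shift_ops t hb; move: IH.
move: (shift_ops _ _) (shift_ops t b) => X Y hE hY.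
rewrite (_ : _ - _ = shift_op (y + z q) (X - l q * Y) + (eta (l q) - cst (z q) * l q) * Y).
  apply: ord_geD; first exact: (@ord_ge_shift_ops _ [:: _]).
  by rewrite -addn2 addnC; apply: ord_geM.
by rewrite /shift_op vfieldD vfieldN vfieldM cstD; ring.
Qed.

(** Modulo order [j.+2], a series of order [j.+1] is a sum of products of some [l q] with a series
    of order [j]. The eigenvalues grow by [z q], so nonnegative ones become positive. *)
Lemma killed_step j :
  (forall b, ord_ge j b -> killed (fun y => 0 <= y) j.+1 b) ->
  forall a, ord_ge j.+1 a -> killed (fun y => 0 < y) j.+2 a.
Proof.
move=> IH a ha; have /choice [c hc] := l_span.
pose b i := divx i a; have hb i : ord_ge j (b i) by apply: ord_ge_divx.
(* Each variable in the decomposition of [hadamard] is replaced by its expansion in the [l q]; the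
   second sum is the error. *)
have -> : a = \sum_i \sum_q l q * (cst (c i q) * b i) +
    \sum_i (ps_var R i - \sum_q cst (c i q) * l q) * b i.
  rewrite {1}(hadamard a) (ha (mzero n)) ?mdeg0 // cst0 add0r -big_split /=.
  apply: eq_bigr => i _; rewrite mulrBl mulr_suml -/(b i).
  under [X in _ - X]eq_bigr do rewrite mulrAC mulrC.
  by rewrite addrC subrK.
apply: killedD; last first.
  by apply: killed_ord; apply: ord_ge_sum => i _; apply: (@ord_geM _ _ 2 j).
apply: killed_sum => i _; apply: killed_sum => q _.
have hcb : ord_ge j (cst (c i q) * b i) by apply: ord_geMl.
have [t t0 ht] := IH _ hcb; exists [seq y + z q | y <- t].
  by rewrite all_map; apply: sub_all t0 => y /= y0; apply: ltr_wpDl.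
have := ord_geD (shift_ops_eigenM q t hcb) (ord_geM (l1 q) ht).
by rewrite subrK.
Qed.

Lemma killed_all k a : ord_ge 1 a -> killed (fun y => 0 < y) k.+1 a.
Proof.
have Q j : forall b, ord_ge j.+1 b -> killed (fun y => 0 < y) j.+2 b.
  elim: j => [|j IH]; apply: killed_step.
    (* On constants the eigenvalue is 0, as [eta] maps every series into order 1; positivity starts
       in degree one. *)
    move=> b _; exists [:: 0] => //=; first by rewrite lexx.
    rewrite /shift_op cst0 mul0r subr0; apply: ord_ge_sum => i _.
    by rewrite mulrC; apply: ord_geMl.
  move=> b /IH [s s0 hs]; exists s => //.
  by apply: sub_all s0 => y; apply: ltW.
(* The graded pieces are annihilated one after another, and the root lists are concatenated. *)
move=> a1; elim: k => [|k [s s0 hs]]; first exact: killed_ord.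
have [t t0 ht] := Q _ _ hs; exists (t ++ s); first by rewrite all_cat t0.
by rewrite shift_ops_cat.
Qed.

End Spectrum.

(** * The Jacobian ideals and the Euler field *)

Section JacobianIdeals.
Variables (R : realType) (n : nat) (f : ps R n).
Notation ps := (ps R n).
Implicit Types a b c : ps.
Hypothesis f_conv : convergent f.
Hypothesis f0 : ord_ge 1 f.

Definition tJ_gen (k : 'I_n + unit) : ps := if k is inl j then ps_deriv j f else f.
Definition mJ_gen (k : 'I_n * 'I_n) : ps := ps_var R k.1 * ps_deriv k.2 f.
Notation inJ := (in_ideal tJ_gen).
Notation inmJ := (in_ideal mJ_gen).

Lemma convergent_tJ_gen k : convergent (tJ_gen k).
Proof. by case: k => // j; apply: convergent_deriv. Qed.

Lemma convergent_mJ_gen k : convergent (mJ_gen k).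
Proof. by apply: convergentM; [apply: convergent_var | apply: convergent_deriv]. Qed.

Lemma tJ_sum (h : 'I_n + unit -> ps) :
  \sum_k h k * tJ_gen k = \sum_j h (inl j) * ps_deriv j f + h (inr tt) * f.
Proof.
by rewrite big_sumType; congr (_ + _); rewrite (big_pred1 tt) // => -[].
Qed.

Lemma in_tJP a : in_tJ f a <-> inJ a.
Proof.
split=> [[h [h0 [ch [ch0 e]]]]|[h ch ->]].
  exists (fun k => if k is inl j then h j else h0); first by case.
  by rewrite tJ_sum; apply/funext => al; rewrite e psDE ps_sumE.
exists (fun j => h (inl j)), (h (inr tt)); do !split=> //.
by move=> al; rewrite tJ_sum psDE ps_sumE.
Qed.

Lemma eqJP a b : eqJ f a b <-> inJ (a - b).
Proof. exact: in_tJP. Qed.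

Lemma mJ_mul c j : convergent c -> ord_ge 1 c -> inmJ (c * ps_deriv j f).
Proof.
move=> cc c1; rewrite (hadamard c) (c1 (mzero n)) ?mdeg0 // cst0 add0r mulr_suml.
apply: ideal_sum => i _; rewrite mulrAC mulrC; apply: idealM; first exact: convergent_divx.
exact: (ideal_gen mJ_gen (i, j)).
Qed.

Lemma strongly_EulerP : inmJ f -> strongly_Euler_homogeneous f.
Proof.
move=> [h ch e]; exists (fun j => \sum_i h (i, j) * ps_var R i); split=> [j|al].
  split; first by apply: convergent_sum => i _; apply: convergentM => //; apply: convergent_var.
  apply/ord_ge1P; apply: ord_ge_sum => i _; apply: ord_geMl; exact: ord_ge_var.
transitivity ((\sum_j (\sum_i h (i, j) * ps_var R i) * ps_deriv j f) al); last exact: ps_sumE.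
rewrite {1}e (eq_bigr (fun p => h (p.1, p.2) * (ps_var R p.1 * ps_deriv p.2 f))); last by case.
rewrite -(pair_bigA _ (fun i j => h (i, j) * (ps_var R i * ps_deriv j f))) exchange_big.
congr (_ al); apply: eq_bigr => j _; rewrite mulr_suml; apply: eq_bigr => i _.
by rewrite mulrA.
Qed.

Lemma mJ_of_approx : (forall k, exists2 p, inmJ p & ord_ge k (f - p)) -> inmJ f.
Proof. exact: ideal_closed convergent_mJ_gen _ f_conv. Qed.

(** Here [ps_deriv j f] is a unit. Instead of inverting it, its inverse is approximated by [z^-1]:
    each correction multiplies the error by [1 - z^-1 * ps_deriv j f], which has order 1, and
    closedness passes to the limit. *)
Lemma smooth_mJ j : ps_deriv j f (mzero n) <> 0 -> inmJ f.
Proof.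
set z := ps_deriv j f _ => /eqP z0; apply: mJ_of_approx => k.
suff [p ip hp] : exists2 p, inmJ p & ord_ge k.+1 (f - p).
  by exists p => //; apply: ord_geW hp.
elim: k => [|k [p ip hp]]; first by exists 0; [exact: ideal0 | rewrite subr0].
have ce : convergent (cst z^-1 * (f - p)).
  apply: convergentM; first exact: convergent_cst.
  by apply: convergentB => //; apply: ideal_convergent convergent_mJ_gen _ ip.
exists (p + cst z^-1 * (f - p) * ps_deriv j f).
  by apply: idealD => //; apply: mJ_mul => //; apply: ord_geMl; apply: ord_geW hp.
have -> : f - (p + cst z^-1 * (f - p) * ps_deriv j f) =
    (f - p) * (1 - cst z^-1 * ps_deriv j f) by ring.
rewrite -addn1; apply: ord_geM => //; apply/ord_ge1P.
by rewrite psDE psNE coef_cstM -/z mulVf // -cst1 coef_cst eqxx subrr.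
Qed.

(* Nakayama's lemma for [f] modulo [m J_f], by approximation. *)
Lemma nakayama_mJ :
  (forall k, exists p u, [/\ inmJ p, convergent u, ord_ge 1 u & ord_ge k (f - (p + u * f))]) ->
  inmJ f.
Proof.
move=> h; apply: mJ_of_approx; elim=> [|k [p ip hp]]; first by exists 0 => //; exact: ideal0.
have [p' [u [ip' cu u1 hu]]] := h k.+1.
exists (p' + u * p); first by apply: idealD => //; apply: idealM.
have -> : f - (p' + u * p) = f - (p' + u * f) + u * (f - p) by ring.
by apply: ord_geD => //; rewrite -add1n; apply: ord_geM.
Qed.

Lemma maximal_mul_tJ c a : convergent c -> ord_ge 1 c -> inJ a ->
  exists p u, [/\ inmJ p, convergent u, ord_ge 1 u & c * a = p + u * f].
Proof.
move=> cc c1 [h ch ->].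
exists (\sum_j c * h (inl j) * ps_deriv j f), (c * h (inr tt)); split.
- by apply: ideal_sum => j _; apply: mJ_mul; [exact: convergentM | rewrite mulrC; exact: ord_geMl].
- exact: convergentM.
- by rewrite mulrC; exact: ord_geMl.
rewrite tJ_sum mulrDr mulr_sumr mulrA; congr (_ + _).
by apply: eq_bigr => j _; rewrite mulrA.
Qed.

(** * Vector fields that preserve the Tjurina ideal *)

Section PreservedIdeal.
Variable g : 'I_n -> ps.
Hypothesis g_conv : forall i, convergent (g i).
Hypothesis g1 : forall i, ord_ge 1 (g i).
Hypothesis g_tJ : forall a, inJ a -> inJ (vfield g a).

(** This space contains [f] and is stable under the field, hence contains every polynomial in the
    field applied to [f]. Membership of [h] in [tJ] alone would not control its derivatives. *)
Definition deriv_tJ h := convergent h /\ forall i, inJ (ps_deriv i h).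

Lemma deriv_tJD a b : deriv_tJ a -> deriv_tJ b -> deriv_tJ (a + b).
Proof.
move=> [ca ha] [cb hb]; split=> [|i]; first exact: convergentD.
by rewrite ps_derivD; apply: idealD.
Qed.

Lemma deriv_tJ_cstM z a : deriv_tJ a -> deriv_tJ (cst z * a).
Proof.
move=> [ca ha]; split=> [|i]; first by apply: convergentM => //; apply: convergent_cst.
by rewrite ps_derivM ps_deriv_cst mul0r add0r; apply: idealM => //; apply: convergent_cst.
Qed.

Lemma deriv_tJ_vfield a : deriv_tJ a -> deriv_tJ (vfield g a).
Proof.
move=> [ca ha]; split=> [|i]; first exact: convergent_vfield.
rewrite deriv_vfield; apply: idealD; first exact: g_tJ.
by apply: ideal_sum => j _; apply: idealM => //; apply: convergent_deriv.
Qed.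

(** The polynomial in the field is split into its constant term and a multiple of the field. The
    constant term is the product of the numbers [- y], nonzero because no root is 0. *)
Lemma shift_ops_tJ (s : seq R[i]) : all (fun y => 0 < y) s ->
  exists2 z, z != 0 & exists2 h, deriv_tJ h & shift_ops g s f = cst z * f + vfield g h.
Proof.
have hf : deriv_tJ f by split=> // i; exact: (ideal_gen tJ_gen (inl i)).
elim: s => [_|y s IH /= /andP [y0 /IH [z z0 [h hh ->]]]].
  exists 1; first exact: oner_neq0.
  exists (cst 0 * f); first exact: deriv_tJ_cstM.
  by rewrite cst0 cst1 mul0r mul1r vfield0 addr0.
exists (- y * z); first by rewrite mulf_neq0 // oppr_eq0 gt_eqF.
exists (cst z * f + vfield g h + cst (- y) * h).
  apply: deriv_tJD; last exact: deriv_tJ_cstM.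
  by apply: deriv_tJD; [exact: deriv_tJ_cstM | exact: deriv_tJ_vfield].
by rewrite /shift_op !vfieldD !vfield_cstM cstM !cstN; ring.
Qed.

Lemma maximal_vfield h : deriv_tJ h ->
  exists p u, [/\ inmJ p, convergent u, ord_ge 1 u & vfield g h = p + u * f].
Proof.
move=> [_ hh].
have /choice [pu hpu] : forall i, exists pu : ps * ps, [/\ inmJ pu.1, convergent pu.2,
    ord_ge 1 pu.2 & g i * ps_deriv i h = pu.1 + pu.2 * f].
  move=> i; have [p [u hpu]] := maximal_mul_tJ (g_conv i) (@g1 i) (hh i).
  by exists (p, u).
exists (\sum_i (pu i).1), (\sum_i (pu i).2); split.
- by apply: ideal_sum => i _; case: (hpu i).
- by apply: convergent_sum => i _; case: (hpu i).
- by apply: ord_ge_sum => i _; case: (hpu i).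
rewrite mulr_suml -big_split; apply: eq_bigr => i _; by case: (hpu i).
Qed.

Lemma mJ_of_spectrum : (forall k, killed g (fun y => 0 < y) k.+1 f) -> inmJ f.
Proof.
move=> kf; apply: nakayama_mJ => k; have [s s0 hs] := kf k.
have [z z0 [h hh e]] := shift_ops_tJ s0.
have [p [u [ip cu u1 eh]]] := maximal_vfield hh.
have cz := @convergent_cst R n (- z^-1).
(* Up to order [k.+1] the relation reads [z * f + (p + u * f) = 0]; it is solved for the first
   [f]. *)
exists (cst (- z^-1) * p), (cst (- z^-1) * u); split.
- exact: idealM.
- exact: convergentM.
- exact: ord_geMl.
have -> : f - (cst (- z^-1) * p + cst (- z^-1) * u * f) = cst z^-1 * shift_ops g s f.
  rewrite e eh cstN.
  transitivity (cst (z^-1 * z) * f + cst z^-1 * (p + u * f)); last by rewrite cstM; ring.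
  by rewrite mulVf // cst1; ring.
by apply: ord_geMl; apply: ord_geW hs.
Qed.

End PreservedIdeal.

(** * Lifting a derivation of the quotient to a vector field *)

Section Lifting.
Variable chi : ps -> ps.
Hypothesis chi_der : derivationO f chi.

Lemma chi_convergent a : convergent a -> convergent (chi a).
Proof. by case: chi_der => + _; apply. Qed.

(** As a map on representatives [chi] is linear, additive and Leibniz only up to [tJ]; every use of
    these rules leaves a defect in the ideal. *)
Lemma chi_lin z a b : convergent a -> convergent b ->
  inJ (chi (cst z * a + b) - (cst z * chi a + chi b)).
Proof.
case: chi_der => _ [_ [h _]] ca cb; have /eqJP := h z a b ca cb.
by rewrite !ps_scaleE.
Qed.

Lemma chiM a b : convergent a -> convergent b ->
  inJ (chi (a * b) - (a * chi b + b * chi a)).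
Proof. by case: chi_der => _ [_ [_ h]] ca cb; apply/eqJP; apply: h. Qed.

Lemma chi0 : inJ (chi 0).
Proof.
have := chi_lin 1 (convergent0 R n) (convergent0 R n).
rewrite cst1 !mul1r addr0 => /idealN.
by rewrite opprB addrK.
Qed.

Lemma chiD a b : convergent a -> convergent b -> inJ (chi (a + b) - (chi a + chi b)).
Proof. by move=> ca cb; have := chi_lin 1 ca cb; rewrite cst1 !mul1r. Qed.

Lemma chi_congr a b : convergent a -> convergent b -> inJ (a - b) -> inJ (chi a - chi b).
Proof.
by case: chi_der => _ [h _] ca cb /eqJP e; apply/eqJP; apply: h.
Qed.

Lemma chi_tJ a : inJ a -> inJ (chi a).
Proof.
move=> ia; have ca := ideal_convergent convergent_tJ_gen ia.
rewrite -[chi a](subrK (chi 0)); apply: idealD chi0; apply: chi_congr => //.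
  exact: convergent0.
by rewrite subr0.
Qed.

Lemma chi_sum (I : Type) (r : seq I) (F : I -> ps) : (forall i, convergent (F i)) ->
  inJ (chi (\sum_(i <- r) F i) - \sum_(i <- r) chi (F i)).
Proof.
move=> cF; elim: r => [|i r IH]; first by rewrite !big_nil subr0; exact: chi0.
rewrite !big_cons; set A := \sum_(j <- r) _ in IH *; set B := \sum_(j <- r) _ in IH *.
have -> : chi (F i + A) - (chi (F i) + B) =
  (chi (F i + A) - (chi (F i) + chi A)) + (chi A - B) by ring.
by apply: idealD => //; apply: chiD => //; apply: convergent_sum.
Qed.

Lemma chi_cst z : inJ (chi (cst z)).
Proof.
have c1 := convergent1 R n.
(* The Leibniz rule for [1 * 1] gives [chi 1 = 2 * chi 1] modulo [tJ]. *)
have h1 : inJ (chi 1).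
  have := chiM c1 c1; rewrite !mul1r => /idealN.
  by rewrite opprB addrK.
have := chi_lin z c1 (convergent0 R n); rewrite mulr1 addr0 => h.
rewrite -[chi (cst z)](subrK (cst z * chi 1 + chi 0)); apply: idealD => //.
apply: idealD chi0; apply: idealM => //; exact: convergent_cst.
Qed.

(* Two derivations into [O / tJ] agreeing on the variables agree modulo every
   power of the maximal ideal, hence agree. *)
Lemma chi_vfield (g : 'I_n -> ps) a :
  (forall i, convergent (g i)) -> (forall i, inJ (chi (ps_var R i) - g i)) ->
  convergent a -> inJ (chi a - vfield g a).
Proof.
move=> cg hg ca; apply: (ideal_closed convergent_tJ_gen).
  by apply: convergentB; [exact: chi_convergent | exact: convergent_vfield].
move=> k; elim: k a ca => [|k IH] a ca; first by exists 0 => //; exact: ideal0.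
pose x (i : 'I_n) := ps_var R i; pose b i := divx i a.
have cx i : convergent (x i) by apply: convergent_var.
have cb i : convergent (b i) by apply: convergent_divx.
have /choice [be hbe] : forall i, exists be, inJ be /\ ord_ge k (chi (b i) - vfield g (b i) - be).
  by move=> i; have [be ? ?] := IH (b i) (cb i); exists be.
have ab : a = cst (a (mzero n)) + \sum_i x i * b i by exact: hadamard.
pose A := cst (a (mzero n)) : ps; pose S := \sum_i x i * b i.
pose e1 := chi a - (chi A + chi S).
pose e2 := chi S - \sum_i chi (x i * b i).
pose e3 i := chi (x i * b i) - (x i * chi (b i) + b i * chi (x i)).
(* All defects of additivity and of the Leibniz rule are collected, together with the approximants
   for the quotients [b i]. The error left is the sum of [x i] times the errors for [b i], hence of
   one order more. *)
exists (e1 + chi A + e2 + \sum_i (e3 i + b i * (chi (x i) - g i) + x i * be i)).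
  apply: idealD; first apply: idealD; first apply: idealD.
  - rewrite /e1 {1}ab; apply: chiD; first exact: convergent_cst.
    by apply: convergent_sum => i _; apply: convergentM.
  - exact: chi_cst.
  - by apply: chi_sum => i; apply: convergentM.
  apply: ideal_sum => i _; apply: idealD; first apply: idealD.
  - exact: chiM.
  - by apply: idealM.
  - by apply: idealM => //; case: (hbe i).
have -> : vfield g a = \sum_i (g i * b i + x i * vfield g (b i)).
  rewrite {1}ab vfieldD vfield_cst add0r vfield_sum; apply: eq_bigr => i _.
  by rewrite vfieldM vfield_var.
have -> : chi a = e1 + chi A + e2 + \sum_i chi (x i * b i) by rewrite /e1 /e2; ring.
rewrite [X in ord_ge _ X](_ : _ = \sum_i x i * (chi (b i) - vfield g (b i) - be i)).
  apply: ord_ge_sum => i _; rewrite -add1n; apply: ord_geM; first exact: ord_ge_var.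
  by case: (hbe i).
move: (e1 + _ + _) => E; rewrite opprD addrACA [E + _]addrC -!addrA.
rewrite [X in _ + X]addrCA addKr.
by rewrite -!sumrN -!big_split; apply: eq_bigr => i _; rewrite /e3 /=; ring.
Qed.

End Lifting.
End JacobianIdeals.

(** * Construction of the Euler field at a singular point *)

Section EulerField.
Variables (R : realType) (n : nat) (f : ps R n).
Notation ps := (ps R n).
Implicit Types a b c : ps.
Hypothesis f_conv : convergent f.
Hypothesis f1 : ord_ge 1 f.
Hypothesis df1 : forall j, ord_ge 1 (ps_deriv j f).
Notation inJ := (in_ideal (tJ_gen f)).

Lemma tJ_ord_ge a : inJ a -> ord_ge 1 a.
Proof.
move=> [h ch ->]; rewrite tJ_sum; apply: ord_geD; last exact: ord_geMl.
by apply: ord_ge_sum => j _; apply: ord_geMl.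
Qed.

(** Its row space is the image of [tJ] in the cotangent space, since the vanishing of the partial
    derivatives at 0 leaves [f] without linear part. *)
Definition hessian : 'M[R[i]]_n := \matrix_k lin (ps_deriv k f).
Notation H := hessian.

Lemma lin_hessian (d : 'rV[R[i]]_n) :
  lin (\sum_k cst (d 0 k) * ps_deriv k f) = d *m H.
Proof.
by rewrite lin_sum mulmx_sum_row; apply: eq_bigr => k _; rewrite lin_cstM rowK.
Qed.

Lemma lin_tJ a : inJ a -> (lin a <= H)%MS.
Proof.
move=> [h ch ->]; rewrite tJ_sum linD lin_sum addmx_sub ?summx_sub //.
  by move=> j _; rewrite linM // scalemx_sub // -(rowK (fun k => lin (ps_deriv k f)) j) row_sub.
rewrite linM // (_ : lin f = 0) ?scaler0 ?sub0mx //.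
by apply/rowP => j; rewrite !mxE -coef_deriv0 (df1 j) ?mdeg0.
Qed.

Variables (m : nat) (y : 'I_m -> ps) (w : 'I_m -> rat) (chi : ps -> ps).
Hypothesis y_max : forall j, in_maxO f (y j).
Hypothesis y_gen : generates_maxO f y predT.
Hypothesis w0 : forall j, 0 < w j.
Hypothesis chi_der : derivationO f chi.
Hypothesis chi_y : forall j, eqJ f (chi (y j)) (ps_scale (ratr (w j)) (y j)).

Lemma generators_ord_ge j : ord_ge 1 (y j).
Proof.
have [_ [z [[_ /ord_ge1P z1] /eqJP /tJ_ord_ge h]]] := y_max j.
by rewrite -(subrK z (y j)); apply: ord_geD.
Qed.

Lemma generators_convergent j : convergent (y j).
Proof. by case: (y_max j). Qed.

Lemma generators_var (i : 'I_n) : exists2 h : 'I_m -> ps, forall j, convergent (h j) &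
  inJ (ps_var R i - \sum_j h j * y j).
Proof.
have cx := convergent_var R i.
have [|h [ch /eqJP e]] := y_gen (a := ps_var R i).
  split=> //; exists (ps_var R i); split.
    by split=> //; apply/ord_ge1P; exact: ord_ge_var.
  by apply/eqJP; rewrite subrr; exact: ideal0.
exists h => //; move: e; congr (in_ideal _ (_ - _)).
by apply/funext => al; rewrite ps_sumE.
Qed.

Lemma chi_generators j : inJ (chi (y j) - cst (ratr (w j)) * y j).
Proof. by have /eqJP := chi_y j; rewrite ps_scaleE. Qed.

(** A derivation may send a variable to a unit. This one does not: modulo [tJ] the variables are
    combinations of the [y j], which [chi] multiplies by scalars. *)
Lemma chi_var_ord_ge (i : 'I_n) : ord_ge 1 (chi (ps_var R i)).
Proof.
have [h ch hi] := generators_var i.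
have chy j : convergent (h j * y j) by apply: convergentM => //; exact: generators_convergent.
have cs : convergent (\sum_j h j * y j) by apply: convergent_sum.
have /tJ_ord_ge e1 := chi_congr chi_der (convergent_var R i) cs hi.
have /tJ_ord_ge e2 := chi_sum chi_der (index_enum 'I_m) chy.
rewrite -[chi _](subrK (chi (\sum_j h j * y j))); apply: ord_geD => //.
rewrite -[chi _](subrK (\sum_j chi (h j * y j))); apply: ord_geD => //.
apply: ord_ge_sum => j _.
have y1 := @generators_ord_ge j; have cy := generators_convergent j.
have /tJ_ord_ge e3 := chiM chi_der (ch j) cy.
rewrite -[chi _](subrK (h j * chi (y j) + y j * chi (h j))); apply: ord_geD => //.
apply: ord_geD; last by rewrite mulrC; exact: ord_geMl.
apply: ord_geMl; rewrite -[chi _](subrK (cst (ratr (w j)) * y j)).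
by apply: ord_geD; [apply: tJ_ord_ge; exact: chi_generators | exact: ord_geMl].
Qed.

Let G0 : 'M[R[i]]_n := \matrix_i lin (chi (ps_var R i)).
(** Chosen so that [Lam *m H = (1%:M - G0) *m P], where [P], acting on rows from the right, projects
    onto the row space of [H]. The corrected linear part then satisfies [G *m P = P]. *)
Let Lam : 'M[R[i]]_n := (1%:M - G0) *m pinvmx H.
Let P : 'M[R[i]]_n := pinvmx H *m H.

(* Correcting the lift by the elements [Lam i k * d_k f] of [tJ] turns its
   linear part into the identity on the span of the linear parts of [tJ]
   without changing it modulo this span. *)
Definition euler_coef (i : 'I_n) : ps :=
  chi (ps_var R i) + \sum_k cst (Lam i k) * ps_deriv k f.
Notation g := euler_coef.

Lemma euler_coef_tJ i : inJ (chi (ps_var R i) - g i).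
Proof.
rewrite /g opprD addNKr; apply: idealN; apply: ideal_sum => k _.
apply: idealM; first exact: convergent_cst.
exact: (ideal_gen (tJ_gen f) (inl k)).
Qed.

Lemma euler_coef_convergent i : convergent (g i).
Proof.
apply: convergentD; first by apply: (chi_convergent chi_der); exact: convergent_var.
apply: convergent_sum => k _; apply: convergentM; first exact: convergent_cst.
exact: convergent_deriv.
Qed.

Lemma euler_coef_ord_ge i : ord_ge 1 (g i).
Proof.
apply: ord_geD; first exact: chi_var_ord_ge.
by apply: ord_ge_sum => k _; apply: ord_geMl.
Qed.

Lemma chi_euler a : convergent a -> inJ (chi a - vfield g a).
Proof.
exact: (chi_vfield f_conv chi_der euler_coef_convergent euler_coef_tJ).
Qed.

Lemma euler_tJ a : inJ a -> inJ (vfield g a).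
Proof.
move=> ia; have ca := ideal_convergent (convergent_tJ_gen f_conv) ia.
rewrite -[vfield g a](subKr (chi a)); apply: idealB; last exact: chi_euler.
exact: (chi_tJ f_conv chi_der).
Qed.

Let G : 'M[R[i]]_n := \matrix_i lin (g i).

Let GE : G = G0 + Lam *m H.
Proof.
apply/row_matrixP => i; rewrite !rowK linD raddfD /= rowK row_mul -lin_hessian.
by congr (_ + lin _); apply: eq_bigr => k _; rewrite [row i Lam 0 k]mxE.
Qed.

Let HP : H *m P = H.
Proof. by rewrite mulmxA mulmxKpV. Qed.

Let PP : P *m P = P.
Proof. by rewrite {1}/P -mulmxA HP. Qed.

Let lin_euler a : lin (vfield g a) = lin a *m G.
Proof. exact: lin_vfield euler_coef_ord_ge. Qed.

Let HG_sub : (H *m G <= H)%MS.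
Proof.
apply/row_subP => k; rewrite row_mul rowK -lin_euler; apply: lin_tJ; apply: euler_tJ.
exact: (ideal_gen (tJ_gen f) (inl k)).
Qed.

Let GP : G *m P = P.
Proof.
have -> : G = G0 + (1%:M - G0) *m P by rewrite GE mulmxA.
by rewrite mulmxBl mul1mx !mulmxDl mulNmx -mulmxA PP addrC subrK.
Qed.

(** The field preserves [tJ], so the rows of [H *m G] lie in the row space of [H] and are fixed by
    [P]; then [G *m P = P] applies. *)
Let HG : H *m G = H.
Proof. by rewrite -[LHS](mulmxKpV HG_sub) -mulmxA -/P -mulmxA GP HP. Qed.

(** The derivatives of [f] are eigenvectors for 1 modulo order 2. Each [y j] is one only modulo
    [tJ]; subtracting a combination of the derivatives removes the projection of its linear part to
    the row space of [H]. *)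
Definition eigenform (q : 'I_m + 'I_n) : ps :=
  match q with
  | inl j => y j - \sum_k cst ((lin (y j) *m pinvmx H) 0 k) * ps_deriv k f
  | inr k => ps_deriv k f
  end.

Definition eigenweight (q : 'I_m + 'I_n) : R[i] :=
  if q is inl j then ratr (w j) else 1.

Lemma eigenform_ord_ge q : ord_ge 1 (eigenform q).
Proof.
case: q => [j|k] //=; apply: ord_geB; first exact: generators_ord_ge.
by apply: ord_ge_sum => k _; exact: ord_geMl.
Qed.

Lemma eigenweight_gt0 q : 0 < eigenweight q.
Proof. by case: q => [j|k] /=; rewrite ?ltr0q ?ltr01. Qed.

Lemma lin_eigenform j : lin (eigenform (inl j)) = lin (y j) - lin (y j) *m P.
Proof. by rewrite linD linN lin_hessian -mulmxA. Qed.

Lemma eigenformP q :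
  ord_ge 2 (vfield g (eigenform q) - cst (eigenweight q) * eigenform q).
Proof.
have e1 := @eigenform_ord_ge q.
apply: ord_ge2P.
  by apply: ord_geB; [exact: ord_ge_vfield euler_coef_ord_ge e1 | exact: ord_geMl].
apply/eqP; rewrite linD linN lin_cstM lin_euler subr_eq0; apply/eqP.
case: q {e1} => [j|k]; last first.
  by rewrite scale1r -(rowK (fun k => lin (ps_deriv k f)) k) -row_mul HG.
rewrite lin_eigenform /=; set v := lin (y j); set z := ratr _.
pose d := v *m G - z *: v.
(* The defect [d] is the linear part of [vfield g (y j) - z * y j], which lies in [tJ] because the
   field agrees with [chi] there. *)
have dP : d *m P = d.
  rewrite mulmxA mulmxKpV // /d -lin_euler -lin_cstM -linN -linD; apply: lin_tJ.
  rewrite (_ : _ - _ = (chi (y j) - cst z * y j) - (chi (y j) - vfield g (y j))); last by ring.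
  apply: idealB; first exact: chi_generators.
  by apply: chi_euler; exact: generators_convergent.
have PG : P *m G = P by rewrite /P -mulmxA HG.
have vG : v *m G = d + z *: v by rewrite subrK.
(* Applying [P] to [d = v *m G - z *: v] determines the defect; it is exactly what subtracting
   [v *m P] from [v] compensates. *)
have dE : d = v *m P - z *: v *m P by rewrite -[LHS]dP mulmxBl -mulmxA GP.
rewrite mulmxBl -mulmxA PG scalerBr scalemxAl vG dE.
by rewrite [LHS]addrC -[X in - _ + X]addrA addKr addrC.
Qed.

Lemma eigenform_span (i : 'I_n) : exists c : 'I_m + 'I_n -> R[i],
  ord_ge 2 (ps_var R i - \sum_q cst (c q) * eigenform q).
Proof.
have [h ch hi] := generators_var i; pose h0 j := h j (mzero n).
(* Constant terms of the coefficients suffice for the [y j]. The linear part left over lies in the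
   row space of [H], and [pinvmx] yields its coordinates in the derivatives of [f]. *)
pose d := (lin (ps_var R i) - \sum_j h0 j *: lin (eigenform (inl j))) *m pinvmx H.
exists (fun q => match q with inl j => h0 j | inr k => d 0 k end).
apply: ord_ge2P.
  apply: ord_geB; first exact: ord_ge_var.
  by apply: ord_ge_sum => q _; apply: ord_geMl; exact: eigenform_ord_ge.
rewrite linD linN big_sumType linD lin_hessian lin_sum opprD addrA.
under eq_bigr do rewrite lin_cstM.
apply/eqP; rewrite subr_eq0 mulmxKpV //.
rewrite (eq_bigr (fun j => h0 j *: lin (y j) - (h0 j *: lin (y j)) *m P)); last first.
  by move=> j _; rewrite lin_eigenform scalerBr scalemxAl.
rewrite big_split opprD addrA addmx_sub //.
  have -> : \sum_j h0 j *: lin (y j) = lin (\sum_j h j * y j).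
    by rewrite lin_sum; apply: eq_bigr => j _; rewrite linM //; exact: generators_ord_ge.
  by rewrite -linN -linD; exact: lin_tJ.
by rewrite sumrN opprK summx_sub // => j _; rewrite mulmxA submxMl.
Qed.

Lemma quasihomogeneous_mJ : in_ideal (mJ_gen f) f.
Proof.
apply: (mJ_of_spectrum f_conv euler_coef_convergent euler_coef_ord_ge euler_tJ) => k.
exact: (killed_all euler_coef_ord_ge eigenform_ord_ge eigenweight_gt0 eigenformP eigenform_span).
Qed.

End EulerField.

Theorem theorem4p6 (R : realType) (n : nat) (f : ps R n) :
  in_max f -> (exists al, f al <> 0) ->
  SingX_quasihomogeneous f -> strongly_Euler_homogeneous f.
Proof.
move=> [f_conv /ord_ge1P f1] _ [m [y [w [chi [[y_max [y_gen _]] [w0 [chi_der chi_y]]]]]]].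
apply: strongly_EulerP.
(* At a smooth point [tJ] is the unit ideal and is treated directly; otherwise [tJ] lies in the
   maximal ideal, as the construction of the Euler field requires. *)
have [[j dj]|df] := pselect (exists j, ps_deriv j f (mzero n) <> 0).
  exact: (smooth_mJ f_conv f1 dj).
apply: (quasihomogeneous_mJ f_conv f1 _ y_max y_gen w0 chi_der chi_y) => j.
by apply/ord_ge1P; apply: contrapT => dj; apply: df; exists j.
Qed.
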